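(* Let $n$ be a non-negative integer and let $F$ be a nonempty filter (upper order ideal) of the poset $I_{n}^{\bullet}$ of pointed integer partitions of $n$. Let $\Pi_{n}^{\bullet}(F)=\{\pi\in\Pi_{n}^{\bullet} : \mathrm{type}(\pi)\in F\}$ and $C_{n}^{\bullet}(F)=\{\vec{c}\in C_{n}^{\bullet} : \mathrm{type}(\vec{c})\in F\}$. Then $$\mu\left(\Pi_{n}^{\bullet}(F)\cup\{\hat{0}\}\right)=\sum_{\vec{c}\in C_{n}^{\bullet}(F)}(-1)^{\rho(\vec{c},\hat{1})}\cdot\mu_{C_{n}^{\bullet}(F)\cup\{\hat{0}\}}(\hat{0},\vec{c})\cdot\beta(\vec{c}).$$
   Context: A pointed integer partition of $n$ is a pair $\{\lambda,\underline{m}\}=\{\lambda_1,\dots,\lambda_k,\underline{m}\}$ where $m\ge 0$ is an integer (the pointed part) and $\lambda=\{\lambda_1,\dots,\lambda_k\}$ is an integer partition (multiset of positive integers) of $n-m$. The poset $I_n^{\bullet}$ of all pointed integer partitions of $n$ is ordered by the cover relations: replacing two non-pointed parts $\lambda_{k-1},\lambda_k$ by their sum $\lambda_{k-1}+\lambda_k$, and replacing a non-pointed part $\lambda_k$ and the pointed part $m$ by the pointed part $\lambda_k+m$ (going up in the order). A filter $F$ is a subset such that $x\le y$, $x\in F$ imply $y\in F$. A pointed set partition of $\{1,\dots,n\}$ is a pair $(\sigma,Z)$ with $Z\subseteq\{1,\dots,n\}$ (the zero block) and $\sigma$ a set partition of $\{1,\dots,n\}\setminus Z$. $\Pi_n^{\bullet}$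 is the poset of these ordered by refinement: $\pi\le\pi'$ if every block of $\pi$ is contained in some block (possibly the zero block) of $\pi'$ and the zero block of $\pi$ is contained in the zero block of $\pi'$. The type of $(\sigma,Z)$ is the pointed integer partition $\{\{|B|:B\in\sigma\},\underline{|Z|}\}$. A pointed composition of $n$ is a list $\vec{c}=(c_1,\dots,c_{k-1},\underline{c_k})$ of non-negative integers with sum $n$ where $c_1,\dots,c_{k-1}$ are positive ($c_k$ may be $0$). $C_n^{\bullet}$ is the poset of these with cover relations given by adding two adjacent entries (if the last entry is involved, the sum becomes the new last, underlined, entry); it is isomorphic to a Boolean algebra with maximum $(\underline{n})$. The type of $\vec{c}$ is the pointed integer partition $\{c_1,\dots,c_{k-1},\underline{c_k}\}$. $\beta(\vec{c})$: if $c_k>0$, it is the number of permutations in $\mathfrak{S}_n$ with descent set exactly $\{c_1,c_1+c_2,\dots,c_1+\dots+c_{k-1}\}$ (descent set of $\tau$ is $\{i:\tau(i)>\tau(i+1)\}$); if $k\ge2$ and $c_k=0$, $\beta(\vec{c})=0$; and $\beta((\underline{0}))=1$. For a poset $P$ with minimum $\hat{0}$ and maximum $\hat{1}$, $\mu(P)$ denotes $\mu_P(\hat{0},\hat{1})$. In $\Pi_n^{\bullet}(F)\cup\{\hat0\}$ and $C_n^{\bullet}(F)\cup\{\hat0\}$, $\hat{0}$ is a newly adjoined minimum, and $\hat{1}$ is the maximum of $\Pi_n^\bullet$ (all elements in the zero block), respectively $(\underline{n})$. $\rho(\vec{c},\hat{1})$ is the rank difference in $C_n^\bullet$ between $\vec{c}$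 and $(\underline{n})$, i.e. $k-1$ if $\vec{c}$ has $k$ entries. *)

(* Defs.v *)
From Stdlib Require Import Relations.
From mathcomp Require Import all_boot all_order all_algebra all_fingroup.
Set Implicit Arguments. Unset Strict Implicit. Unset Printing Implicit Defensive.
Import Order.TTheory GRing.Theory Num.Theory.
Local Open Scope ring_scope.

(* [s] lists the elements of the poset, [le] is its order relation.
   mu(x,x) = 1, mu(x,y) = - sum_{x <= z < y} mu(x,z) if x < y, 0 otherwise.
   The fuel (size s).+1 exceeds the length of any strict chain. *)
Fixpoint mobF (T : eqType) (s : seq T) (le : rel T) (k : nat) (x y : T) : int :=
  match k with
  | 0%N => 0
  | k'.+1 =>
      if x == y then 1
      else if le x y then
        - \sum_(z <- s | le x z && le z y && (z != y)) mobF s le k' x z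
      else 0
  end.

Definition mobius (T : eqType) (s : seq T) (le : rel T) (x y : T) : int :=
  mobF s le (size s).+1 x y.

Definition with_bot (T : eqType) (s : seq T) : seq (option T) :=
  None :: [seq Some x | x <- s].

Definition le_bot (T : Type) (le : rel T) : rel (option T) :=
  fun x y => match x, y with
             | None, _ => true
             | Some _, None => false
             | Some a, Some b => le a b
             end.

(* A pointed integer partition is (lambda, m); lambda is the multiset of
   non-pointed parts, stored canonically as a nonincreasing list. *)
Definition pip := (seq nat * nat)%type.

Definition canon (l : seq nat) : seq nat := sort geq l.

Definition is_pip (n : nat) (x : pip) : bool :=
  [&& sorted geq x.1, all (fun k => 0 < k)%N x.1 & (sumn x.1 + x.2 == n)%N].

Definition pip_cover (x y : pip) : Prop :=
  (exists a b l, perm_eq x.1 [:: a, b & l] /\ y = (canon ((a + b)%N :: l), x.2))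
  \/ (exists a l, perm_eq x.1 (a :: l) /\ y = (canon l, (a + x.2)%N)).

Definition pip_le (n : nat) : relation pip :=
  @clos_refl_trans pip (fun x y => is_pip n x /\ pip_cover x y).

Definition is_nonempty_filter (n : nat) (F : pred pip) : Prop :=
  [/\ (forall x, F x -> is_pip n x),
      (exists x, F x) &
      (forall x y, pip_le n x y -> F x -> F y)].

Definition psp (n : nat) := ({set {set 'I_n}} * {set 'I_n})%type.

Definition is_psp (n : nat) (p : psp n) : bool := finset.partition p.1 (~: p.2).

Definition psp_le (n : nat) : rel (psp n) := fun p q =>
  (p.2 \subset q.2) &&
  [forall B in p.1, (B \subset q.2) || [exists B' in q.1, B \subset B']].

Definition psp_type (n : nat) (p : psp n) : pip :=
  (canon (map (fun B : {set 'I_n} => #|B|) (enum p.1)), #|p.2|).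

Definition psp_top (n : nat) : psp n := (set0, [set: 'I_n]).

Definition PiF (n : nat) (F : pred pip) : seq (psp n) :=
  [seq p <- (enum [set: {set {set 'I_n}} * {set 'I_n}] : seq (psp n)) | is_psp p && F (psp_type p)].

Definition init (c : seq nat) : seq nat :=
  if c is x :: t then belast x t else [::].

Definition is_pcomp (n : nat) (c : seq nat) : bool :=
  [&& (0 < size c)%N, all (fun k => 0 < k)%N (init c) & (sumn c == n)%N].

Fixpoint allseqs (k b : nat) : seq (seq nat) :=
  match k with
  | 0%N => [:: [::]]
  | k'.+1 => [seq x :: t | x <- iota 0 b.+1, t <- allseqs k' b]
  end.

(* all pointed compositions of n (each has at most n+1 entries, all <= n) *)
Definition pcomps (n : nat) : seq (seq nat) :=
  [seq c <- flatten [seq allseqs k n | k <- iota 1 n.+1] | is_pcomp n c].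

Definition pcomp_type (c : seq nat) : pip := (canon (init c), last 0 c).

Definition merges (c : seq nat) : seq (seq nat) :=
  [seq take i c ++ (nth 0 c i + nth 0 c i.+1)%N :: drop i.+2 c
  | i <- iota 0 (size c).-1].

Fixpoint reach (k : nat) (c : seq nat) : seq (seq nat) :=
  match k with
  | 0%N => [:: c]
  | k'.+1 => c :: flatten [seq reach k' d | d <- merges c]
  end.

Definition pcomp_le : rel (seq nat) := fun c d => d \in reach (size c) c.

Definition CF (n : nat) (F : pred pip) : seq (seq nat) :=
  [seq c <- pcomps n | F (pcomp_type c)].

(* descent set of a permutation (positions 1..n-1, 1-indexed) *)
Definition descents (n : nat) (s : 'S_n) : seq nat :=
  let w := [seq val (s j) | j <- enum 'I_n] in
  [seq i.+1 | i <- iota 0 n.-1 & (nth 0 w i > nth 0 w i.+1)%N].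

Definition psums (c : seq nat) : seq nat :=
  [seq sumn (take i.+1 c) | i <- iota 0 (size c).-1].

Definition beta (n : nat) (c : seq nat) : nat :=
  if c == [:: 0%N] then 1%N
  else if last 0 c == 0%N then 0%N
  else #|[set s : 'S_n | [forall i : 'I_n.+1,
                           (val i \in descents s) == (val i \in psums c)]]|.

(* Main.v *)
(* Let f be the Moebius function from the adjoined bottom.  Its sums over lower
   sets all equal -1, so pairing with a function g whose sums over the intervals
   [z, d] vanish unless z = d gives f d = - sum_(x <= d) g x.  For pointed set
   partitions, g x = (-1)^m m! where m is the number of nonzero blocks of x, and
   m! counts the orderings of these blocks; for compositions, which form a
   Boolean algebra, g is a sign.  Thus the left-hand side is a signed count of
   ordered pointed set partitions by composition c; their number is the number of
   permutations whose descent set is contained in the set of proper partial sums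
   of c, i.e. the sum of beta d over the d above c.  Exchanging the sums over c
   and d concludes. *)

From Stdlib Require Import Relation_Operators.
Require Import Defs.
From mathcomp Require Import all_boot all_order all_algebra all_fingroup.
From mathcomp Require Import zify.
Import GRing.Theory.
Local Open Scope ring_scope.

Set Implicit Arguments.
Unset Strict Implicit.
Unset Printing Implicit Defensive.

(** * Moebius function with an adjoined bottom *)

(** The duality needs interval sums only for [z] in the filter, and a filter contains everything
    above [z], so the condition on types drops out of these sums. This is where monotonicity of
    [psp_type] and [pcomp_type] enters. The weight (-1)^m m! is realised by words, in which one
    block of [z] can be split off from, or merged with, the following letter. The last letter may be
    absent; this mirrors the possibly empty zero block and keeps the cancellation free of
    exceptions. Words with prescribed letter multiplicities are matched with permutations by
    sorting. A composition with several entries, the last being 0, has [n] among its partial sums,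
    and no permutation has a descent at [n]; so the vanishing of [beta] there agrees with the count
    of permutations by descent set, provided that partial sums range over [n] values instead of
    [n - 1]. *)

Section Mobius.
Variables (T : eqType) (s : seq T) (le : rel T).
Hypothesis s_uniq : uniq s.
Hypothesis le_refl : {in s, forall x, le x x}.
Hypothesis le_anti : {in s &, forall x y, le x y -> le y x -> x = y}.
Hypothesis le_trans : {in s & &, forall x y z, le x y -> le y z -> le x z}.

Let mu k x := mobF (with_bot s) (le_bot le) k None (Some x).
Let muB x := mobius (with_bot s) (le_bot le) None (Some x).

(** The 1 is the term of the bottom itself, whose evaluation takes a unit of fuel; hence [k.+2]. *)
Lemma mobF_bot_rec k x :
  mu k.+2 x = - (1 + \sum_(z <- s | le z x && (z != x)) mu k.+1 z).
Proof. by rewrite /mu [LHS]/= big_cons /= big_map. Qed.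

(** This decrease makes the number of elements below [x] a bound on the depth of the recursion. *)
Lemma count_le_lt {x z} : x \in s -> z \in s -> le z x -> z != x ->
  (count (le^~ z) s < count (le^~ x) s)%N.
Proof.
move=> xs zs zx neq_zx; rewrite -!size_filter.
have sub : {subset x :: [seq y <- s | le y z] <= [seq y <- s | le y x]}.
  move=> y; rewrite inE mem_filter => /orP[/eqP->|/andP[yz ys]].
    by rewrite mem_filter le_refl.
  by rewrite mem_filter ys (le_trans ys zs xs yz zx).
apply: (uniq_leq_size _ sub); rewrite /= filter_uniq // andbT.
rewrite mem_filter xs andbT; apply: contra neq_zx => xz.
by rewrite (le_anti zs xs).
Qed.

Lemma mobF_bot_fuel k k' x : x \in s ->
  (count (le^~ x) s < k)%N -> (count (le^~ x) s < k')%N ->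
  mu k.+1 x = mu k'.+1 x.
Proof.
elim: k k' x => [|k IHk] [|k'] x xs // lt_k lt_k'.
rewrite !mobF_bot_rec big_seq_cond [in RHS]big_seq_cond.
congr (- (1 + _)); apply: eq_bigr => z /andP[zs /andP[zx neq_zx]].
by have lt_zx := count_le_lt xs zs zx neq_zx; apply: IHk => //; lia.
Qed.

Lemma mobius_bot_sum x : x \in s -> \sum_(z <- s | le z x) muB z = -1.
Proof.
(* The adjoined bottom lengthens the list by one, so [mobius] starts with fuel [(size s).+2]. *)
have muBE z : muB z = mu (size s).+2 z.
  by rewrite /muB /mobius [size (_ :: _)]/= size_map.
move=> xs; rewrite big_mkcond (bigD1_seq x) //= le_refl //.
rewrite muBE mobF_bot_rec -big_mkcondr /=.
rewrite [X in _ + X](_ : _ =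
    \sum_(z <- s | le z x && (z != x)) mu (size s).+1 z).
  by rewrite opprD subrK.
rewrite big_seq_cond [in RHS]big_seq_cond.
apply: eq_big => [z|z /andP[zs /andP[neq_zx zx]]].
  by congr (_ && _); rewrite andbC.
have lt_zx := count_le_lt xs zs zx neq_zx.
have := count_size (le^~ x) s => le_x.
by rewrite muBE; apply: mobF_bot_fuel => //; lia.
Qed.

(* Pairing [mobius_bot_sum] with a function [g] that inverts the zeta function
   from above at [d] isolates the value at [d]. *)
Lemma mobius_bot_dual (g : T -> int) d : d \in s ->
  {in s, forall z, le z d ->
    \sum_(x <- s | le z x && le x d) g x = (z == d)%:R} ->
  muB d = - \sum_(x <- s | le x d) g x.
Proof.
move=> ds Hg.
transitivity (\sum_(z <- s | le z d) muB z * (z == d)%:R).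
  rewrite big_mkcond (bigD1_seq d) //= le_refl // eqxx mulr1 big1 ?addr0 //.
  by move=> z /negPf->; rewrite mulr0 if_same.
transitivity (\sum_(z <- s | le z d)
                \sum_(x <- s | le z x && le x d) muB z * g x).
  rewrite big_seq_cond [in RHS]big_seq_cond.
  by apply: eq_bigr => z /andP[zs zd]; rewrite -mulr_sumr Hg.
have -> : \sum_(z <- s | le z d)
            \sum_(x <- s | le z x && le x d) muB z * g x
   = \sum_(x <- s | le x d) \sum_(z <- s | le z x) muB z * g x.
  rewrite (exchange_big_dep (fun x => le x d)) /=; last by move=> z x _ /andP[].
  rewrite big_seq_cond [in RHS]big_seq_cond.
  apply: eq_bigr => x /andP[xs xd].
  rewrite big_seq_cond [in RHS]big_seq_cond.
  apply: eq_bigl => z; case zs: (z \in s) => //=; rewrite xd andbT.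
  by case zx: (le z x); rewrite ?andbF // (le_trans zs xs ds).
rewrite -sumrN big_seq_cond [in RHS]big_seq_cond.
by apply: eq_bigr => x /andP[xs xd]; rewrite -mulr_suml mobius_bot_sum // mulN1r.
Qed.

End Mobius.
(** * Pointed compositions *)

Lemma psums_cons x y t :
  psums [:: x, y & t] = x :: [seq (x + k)%N | k <- psums (y :: t)].
Proof.
rewrite /psums /= addn0; congr (_ :: _).
by rewrite -[in LHS](addn0 1%N) iotaDl -!map_comp.
Qed.

Lemma size_psums c : size (psums c) = (size c).-1.
Proof. by rewrite size_map size_iota. Qed.

Lemma mem_psums c x :
  reflect (exists2 i, (0 < i < size c)%N & x = sumn (take i c)) (x \in psums c).
Proof.
apply: (iffP mapP) => [[i + ->]|[[//|i] ltic ->]].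
  by rewrite mem_iota => lti; exists i.+1 => //; lia.
by exists i => //; rewrite mem_iota; lia.
Qed.

Lemma init_cons x y t : init [:: x, y & t] = x :: init (y :: t).
Proof. by []. Qed.

Lemma init_rcons t x : init (rcons t x) = t.
Proof. by case: t => //= y t; rewrite belast_rcons. Qed.

Lemma size_init c : size (init c) = (size c).-1.
Proof. by case: c => //= x t; rewrite size_belast. Qed.

Lemma init_last c : (0 < size c)%N -> c = rcons (init c) (last 0%N c).
Proof. by case: c => //= x t _; rewrite -lastI. Qed.

(** Positivity is asked of [init] only: [psums] omits the total, so the last entry is never
    added. *)
Lemma psums_sorted c : all (fun k => 0 < k)%N (init c) -> path ltn 0 (psums c).
Proof.
elim: c => [//|x [//|y t] IHt]; rewrite init_cons psums_cons.
case/andP=> x_gt0 /IHt; rewrite /= x_gt0 /=.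
rewrite -{1}[x]addn0 (path_map (f := addn x)).
by apply: sub_path => a b; rewrite /= ltn_add2l.
Qed.

(** The partial sums determine all entries but the last, and the total determines that one. *)
Lemma psums_inj c d : (0 < size c)%N -> (0 < size d)%N -> sumn c = sumn d ->
  psums c = psums d -> c = d.
Proof.
elim: c d => [//|x [|y t] IHt] [//|x' [|y' t']] _ _.
- by rewrite /= !addn0 => ->.
- by rewrite psums_cons.
- by rewrite psums_cons.
rewrite !psums_cons /= => eq_sum [eq_x]; rewrite -eq_x in eq_sum *.
move/(inj_map (@addnI x))=> /(IHt (y' :: t') isT isT) -> //.
by move/addnI: eq_sum.
Qed.

Section Pset.
Variable n : nat.
Implicit Types (c d : seq nat) (A : {set 'I_n}).

(* The composition [c] of [n] is encoded by the set of its proper partial sums,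
   shifted by one so that they fit in ['I_n]. *)
Definition pset c : {set 'I_n} := [set a : 'I_n | a.+1 \in psums c].

(** The bound [n] is attained exactly when the last of several entries is 0; hence [pset] lives in
    ['I_n], with one point more than there are possible descents when [n] is positive. *)
Lemma psums_bound c x : is_pcomp n c -> x \in psums c -> (0 < x <= n)%N.
Proof.
case/and3P=> _ c_pos /eqP<- cx; apply/andP; split; last first.
  by case/mem_psums: cx => i _ ->; rewrite -{2}(cat_take_drop i c) sumn_cat leq_addr.
have /(order_path_min ltn_trans)/allP := psums_sorted c_pos.
by apply.
Qed.

Lemma pset_sub c d : is_pcomp n d ->
  (pset d \subset pset c) = all (mem (psums c)) (psums d).
Proof.
move=> d_comp; apply/subsetP/allP => [sub x dx | sub a].
  have /andP[x_gt0 x_le] := psums_bound d_comp dx.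
  have ltx : (x.-1 < n)%N by lia.
  by have := sub (Ordinal ltx); rewrite !inE /= prednK // => ->.
by rewrite !inE => /sub.
Qed.

Lemma pset_inj c d : is_pcomp n c -> is_pcomp n d -> pset c = pset d -> c = d.
Proof.
move=> c_comp d_comp eq_set.
have sub_cd : {subset psums c <= psums d}.
  by apply/allP; rewrite -pset_sub // eq_set.
have sub_dc : {subset psums d <= psums c}.
  by apply/allP; rewrite -pset_sub // eq_set.
case/and3P: c_comp d_comp => c_gt0 c_pos /eqP sc /and3P[d_gt0 d_pos /eqP sd].
apply: psums_inj => //; first by rewrite sc.
apply: (irr_sorted_eq ltn_trans ltnn).
- exact: (path_sorted (psums_sorted c_pos)).
- exact: (path_sorted (psums_sorted d_pos)).
by move=> x; apply/idP/idP => [/sub_cd|/sub_dc].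
Qed.

Lemma card_pset c : is_pcomp n c -> #|pset c| = (size c).-1.
Proof.
move=> c_comp; rewrite -size_psums.
case/and3P: (c_comp) => _ c_pos _.
have c_uniq : uniq (psums c).
  exact: (sorted_uniq ltn_trans ltnn (path_sorted (psums_sorted c_pos))).
rewrite cardE -(size_map (fun a : 'I_n => a.+1)).
apply: perm_size; apply: uniq_perm => //.
  by rewrite map_inj_uniq ?enum_uniq // => a b [] /ord_inj.
move=> x; apply/mapP/idP => [[a + ->]|cx]; first by rewrite mem_enum inE.
have /andP[x_gt0 x_le] := psums_bound c_comp cx.
have ltx : (x.-1 < n)%N by lia.
by exists (Ordinal ltx); rewrite ?mem_enum ?inE /= prednK.
Qed.

(** The inverse of [psums]: gaps between consecutive partial sums, where the appended [n] closes the
    last gap, possibly 0. *)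
Definition diffs a l : seq nat := pairmap (fun x y => (y - x)%N) a (rcons l n).

Lemma diffsP a l : path ltn a l -> all (fun x => x <= n)%N l -> (a <= n)%N ->
  [/\ sumn (diffs a l) = (n - a)%N, all (fun k => 0 < k)%N (init (diffs a l))
    & psums (diffs a l) = [seq (x - a)%N | x <- l] ].
Proof.
elim: l a => [|x l IHl] a /=; first by rewrite /diffs /= addn0.
case/andP=> lt_ax pl /andP[le_xn ln] le_an.
have [] := IHl x pl ln le_xn; rewrite /diffs /=.
case E: (pairmap _ _ _) => [|y t].
  by move/(congr1 size): E; rewrite size_pairmap size_rcons.
move=> s_sum s_pos s_ps; split.
- by move: s_sum => /=; lia.
- by move: s_pos => /= ->; rewrite subn_gt0 lt_ax.
rewrite psums_cons s_ps -map_comp; congr (_ :: _).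
have /(order_path_min ltn_trans)/allP lt_l := pl.
by apply/eq_in_map => z /lt_l /=; lia.
Qed.

Lemma pset_surj A : exists2 c, is_pcomp n c & pset c = A.
Proof.
pose l := [seq (a : 'I_n).+1 | a <- enum A].
have l_sorted : path ltn 0 l.
  rewrite path_min_sorted; last by apply/allP=> _ /mapP[a _ ->].
  rewrite /l (map_comp succn val) sorted_map.
  apply: (sub_sorted (e := ltn)) => //.
  apply: (subseq_sorted ltn_trans _ (iota_ltn_sorted 0 n)).
  by rewrite -val_enum_ord map_subseq // /enum_mem filter_predT filter_subseq.
have l_le : all (fun x => x <= n)%N l by apply/allP=> _ /mapP[a _ ->].
have [c_sum c_pos c_ps] := diffsP l_sorted l_le (leq0n n).
exists (diffs 0 l).
  by rewrite /is_pcomp c_sum c_pos subn0 eqxx /diffs size_pairmap size_rcons.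
apply/setP=> a; rewrite inE c_ps (eq_map (g := id)) ?map_id => [|x]; last exact: subn0.
by rewrite mem_map ?mem_enum // => x y [] /ord_inj.
Qed.

Lemma allseqsS k b :
  allseqs k.+1 b = [seq x :: t | x <- iota 0 b.+1, t <- allseqs k b].
Proof. by []. Qed.

Lemma is_pcomp_mem c : is_pcomp n c -> c \in pcomps n.
Proof.
move=> c_comp; rewrite mem_filter c_comp andTb.
(* A composition has one entry more than its [pset] has elements, hence at most [n.+1], where the
   enumeration stops. *)
have sz_c : (0 < size c <= n.+1)%N.
  case/and3P: (c_comp) => -> _ _ /=.
  by have := max_card (pset c); rewrite card_pset // card_ord; case: size.
apply/flattenP; exists (allseqs (size c) n).
  by apply/mapP; exists (size c) => //; rewrite mem_iota; lia.
case/and3P: c_comp => _ _ /eqP <-.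
suff H b : (sumn c <= b)%N -> c \in allseqs (size c) b by apply: H.
elim: c {sz_c} => [//|x c IHc] le_b; rewrite [size _]/= allseqsS.
apply: allpairs_f; first by rewrite mem_iota; move: le_b => /=; lia.
by apply: IHc; move: le_b => /=; lia.
Qed.

Lemma allseqs_uniq k b : uniq (allseqs k b).
Proof.
elim: k => // k IHk; rewrite allseqsS.
apply: allpairs_uniq; rewrite ?IHk ?iota_uniq //.
by move=> [x t] [y u] _ _ [-> ->].
Qed.

Lemma size_allseqs k b c : c \in allseqs k b -> size c = k.
Proof.
elim: k c => [|k IHk] c; first by rewrite inE => /eqP->.
by rewrite allseqsS; case/allpairsP=> [[x t]] /= [_ /IHk <- ->].
Qed.

Lemma pcomps_uniq : uniq (pcomps n).
Proof.
apply: filter_uniq; have := iota_uniq 1 n.+1.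
elim: (iota 1 n.+1) => //= k s IHs /andP[ks /IHs s_uniq].
rewrite cat_uniq allseqs_uniq s_uniq andbT; apply/hasPn=> c.
case/flattenP=> _ /mapP[k' sk' ->] /size_allseqs size_c.
by apply: contra ks => /size_allseqs <-; rewrite size_c.
Qed.

(** Moves sums over compositions to the Boolean algebra of subsets of ['I_n]. *)
Lemma pcomps_pset_sum (P : pred {set 'I_n}) (E : {set 'I_n} -> int) :
  \sum_(c <- pcomps n | P (pset c)) E (pset c) = \sum_(A | P A) E A.
Proof.
rewrite -(big_map pset P E); apply: perm_big; apply: uniq_perm.
- rewrite map_inj_in_uniq ?pcomps_uniq // => c d.
  by rewrite !mem_filter => /andP[c_comp _] /andP[d_comp _]; apply: pset_inj.
- exact: index_enum_uniq.
move=> A; rewrite mem_index_enum; apply/mapP.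
by have [c c_comp <-] := pset_surj A; exists c => //; apply: is_pcomp_mem.
Qed.

End Pset.
(** * Orders on the types *)

Lemma canonP l1 l2 : reflect (canon l1 = canon l2) (perm_eq l1 l2).
Proof.
apply: (perm_sortP (leT := geq)) => [x y|y x z /= yx zy|x y /andP[yx xy]] /=.
- exact: leq_total.
- exact: leq_trans yx.
- by apply/eqP; rewrite eqn_leq; apply/andP.
Qed.

Section PipOrder.
Variable n : nat.

(** Unsorted lists stand for multisets, so that parts can be concatenated and permuted without
    sorting at each step. *)
Definition raw_le (l : seq nat) m l' m' := pip_le n (canon l, m) (canon l', m').

Lemma is_pip_canon l m :
  all (fun k => 0 < k)%N l -> (sumn l + m)%N = n -> is_pip n (canon l, m).
Proof.
move=> l_pos l_sum; rewrite /is_pip /= /canon.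
have perm_l := permEl (perm_sort geq l).
rewrite (perm_all _ perm_l) l_pos (perm_sumn perm_l) l_sum eqxx andbT.
by rewrite sort_sorted // => x y /=; apply: leq_total.
Qed.

Lemma raw_le_refl l m : raw_le l m l m.
Proof. exact: rt_refl. Qed.

Lemma raw_le_trans l2 m2 l1 m1 l3 m3 :
  raw_le l1 m1 l2 m2 -> raw_le l2 m2 l3 m3 -> raw_le l1 m1 l3 m3.
Proof. exact: rt_trans. Qed.

Lemma raw_le_perm l1 l2 l1' l2' m m' : perm_eq l1 l1' -> perm_eq l2 l2' ->
  raw_le l1 m l2 m' -> raw_le l1' m l2' m'.
Proof. by rewrite /raw_le => /canonP-> /canonP->. Qed.

Lemma raw_le_merge a b l m :
  all (fun k => 0 < k)%N [:: a, b & l] -> (sumn [:: a, b & l] + m)%N = n ->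
  raw_le [:: a, b & l] m ((a + b)%N :: l) m.
Proof.
move=> l_pos l_sum; apply: rt_step; split; first exact: is_pip_canon.
by left; exists a, b, l; rewrite /= perm_sort.
Qed.

Lemma raw_le_absorb a l m :
  all (fun k => 0 < k)%N (a :: l) -> (sumn (a :: l) + m)%N = n ->
  raw_le (a :: l) m l (a + m)%N.
Proof.
move=> l_pos l_sum; apply: rt_step; split; first exact: is_pip_canon.
by right; exists a, l; rewrite /= perm_sort.
Qed.

Lemma raw_le_merge_seq t l m : t != [::] ->
  all (fun k => 0 < k)%N (t ++ l) -> (sumn (t ++ l) + m)%N = n ->
  raw_le (t ++ l) m (sumn t :: l) m.
Proof.
case: t => // a t _; elim: t a => [|b t IHt] a l_pos l_sum.
  by rewrite /= addn0; apply: raw_le_refl.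
apply: (raw_le_trans (raw_le_merge l_pos l_sum)).
have -> : sumn [:: a, b & t] = sumn ((a + b)%N :: t) by rewrite /= addnA.
apply: IHt; last by rewrite -l_sum /= !addnA.
by case/and3P: l_pos => a_gt0 _ tl_pos; rewrite /= addn_gt0 a_gt0.
Qed.

Lemma raw_le_absorb_seq t l m :
  all (fun k => 0 < k)%N (t ++ l) -> (sumn (t ++ l) + m)%N = n ->
  raw_le (t ++ l) m l (sumn t + m)%N.
Proof.
elim: t m => [|a t IHt] m l_pos l_sum; first exact: raw_le_refl.
apply: (raw_le_trans (raw_le_absorb l_pos l_sum)).
rewrite /= -addnA addnCA; apply: IHt; first by case/andP: l_pos.
by rewrite -l_sum /=; lia.
Qed.

Lemma raw_le_flatten ls l m : all (fun t => t != [::]) ls ->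
  all (fun k => 0 < k)%N (flatten ls ++ l) -> (sumn (flatten ls ++ l) + m)%N = n ->
  raw_le (flatten ls ++ l) m (map sumn ls ++ l) m.
Proof.
elim: ls l => [|t ls IHls] l /=; first by move=> *; apply: raw_le_refl.
case/andP=> t_n0 ls_n0 l_pos l_sum; rewrite -!catA in l_pos l_sum *.
apply: (raw_le_trans (raw_le_merge_seq t_n0 l_pos l_sum)).
apply: (@raw_le_perm (flatten ls ++ sumn t :: l) (map sumn ls ++ sumn t :: l)).
- by rewrite -cat1s perm_catCA.
- by rewrite -[sumn t :: l]cat1s perm_catCA.
apply: IHls => //; last by rewrite -l_sum !sumn_cat /=; lia.
move: l_pos; rewrite !all_cat /= => /and3P[t_pos -> ->]; rewrite andbT /=.
by case: t t_n0 t_pos {l_sum} => //= a t _ /andP[a_gt0 _]; rewrite addn_gt0 a_gt0.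
Qed.

(** The shape of a general coarsening: [t] lists the parts swallowed by the pointed part, each list
    in [ls] the parts fused into one. *)
Lemma raw_le_coarsen ls t m : all (fun t => t != [::]) ls ->
  all (fun k => 0 < k)%N (t ++ flatten ls) -> (sumn (t ++ flatten ls) + m)%N = n ->
  raw_le (t ++ flatten ls) m (map sumn ls) (sumn t + m)%N.
Proof.
move=> ls_n0 l_pos l_sum; apply: (raw_le_trans (raw_le_absorb_seq l_pos l_sum)).
rewrite -[flatten ls]cats0 -[map sumn ls]cats0; apply: raw_le_flatten => //.
  by move: l_pos; rewrite cats0 all_cat => /andP[].
by rewrite cats0 -l_sum sumn_cat; lia.
Qed.

End PipOrder.

(** * Merging of compositions as removal of partial sums *)

Section CompOrder.
Variable n : nat.

Lemma mergesP c d : reflect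
  (exists p a b q, c = p ++ [:: a, b & q] /\ d = p ++ (a + b)%N :: q)
  (d \in merges c).
Proof.
apply: (iffP mapP) => [[i + ->]|[p [a [b [q [-> ->]]]]]].
  rewrite mem_iota add0n => /= lt_i.
  exists (take i c), (nth 0%N c i), (nth 0%N c i.+1), (drop i.+2 c); split=> //.
  by rewrite -!drop_nth ?cat_take_drop //; lia.
exists (size p); first by rewrite mem_iota size_cat /=; lia.
rewrite take_size_cat // !nth_cat ltnn subnn ltnNge leqnSn subSnn /=.
by rewrite drop_cat ltnNge -addn2 leq_addr addKn /= drop0.
Qed.

Lemma merge_pcomp p a b q :
  is_pcomp n (p ++ [:: a, b & q]) -> is_pcomp n (p ++ (a + b)%N :: q).
Proof.
rewrite /is_pcomp !size_cat !sumn_cat /= !addnS -addnA.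
case/and3P=> _ + /eqP->; rewrite eqxx andbT /=; elim: p => [|x [|y p] IHp] /=.
- by case: q => //= z q /and3P[a_gt0 _ ->]; rewrite addn_gt0 a_gt0.
- by move: IHp => /= IHp /andP[-> /IHp].
by move: IHp => /= IHp /andP[-> /IHp].
Qed.

Lemma merge_type p a b q : is_pcomp n (p ++ [:: a, b & q]) ->
  pip_le n (pcomp_type (p ++ [:: a, b & q])) (pcomp_type (p ++ (a + b)%N :: q)).
Proof.
have initE r x t : init (r ++ x :: t) = r ++ init (x :: t).
  by elim: r => //= y [|z r] //= ->.
case/and3P=> _; rewrite /pcomp_type !initE !last_cat /= -/(raw_le _ _ _ _ _).
(* If [q] is empty, [b] is the pointed part and the merge absorbs [a] into it; otherwise two
   non-pointed parts are added. *)
case: q => [|z q] /= c_pos /eqP c_sum.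
  apply: (@raw_le_perm _ (a :: p) p) => //; first by rewrite cats1 perm_sym perm_rcons.
    by rewrite cats0.
  apply: raw_le_absorb; first by move: c_pos; rewrite all_cat /= andbT andbC.
  by rewrite -c_sum sumn_cat /=; lia.
apply: (@raw_le_perm _ ([:: a, b & p ++ belast z q]) ((a + b)%N :: p ++ belast z q)).
- by rewrite (perm_catCA [:: a; b]).
- by rewrite -cat1s perm_catCA.
apply: raw_le_merge; first by move: c_pos; rewrite !all_cat /= !all_cat; lia.
have := congr1 sumn (lastI z q); rewrite sumn_rcons -c_sum /= !sumn_cat /=.
by lia.
Qed.

(** Prefixes of length at most [size p] are common to both lists, and a longer prefix after the
    merge corresponds to one with an extra entry before it; only the cut between [a] and [b] has no
    counterpart. *)
Lemma merge_psums p a b q (x : nat) :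
  x \in psums (p ++ [:: a, b & q]) =
    (x == sumn (rcons p a)) || (x \in psums (p ++ (a + b)%N :: q)).
Proof.
have take1 j : (j <= size p)%N ->
    take j (p ++ [:: a, b & q]) = take j (p ++ (a + b)%N :: q).
  by move=> lejp; rewrite !takel_cat.
have take2 j : (size p < j)%N ->
    sumn (take j.+1 (p ++ [:: a, b & q])) = sumn (take j (p ++ (a + b)%N :: q)).
  move=> ltpj; have -> : j = (size p + (j - size p).-1.+1)%N by lia.
  by rewrite -addnS !take_cat !ltnNge !leq_addr !addKn /= !sumn_cat /= !addnA.
have takep : sumn (rcons p a) = sumn (take (size p).+1 (p ++ [:: a, b & q])).
  by rewrite -cat_rcons take_size_cat // size_rcons.
apply/mem_psums/predU1P => [[i lti ->]|[->|]].
- case: (ltngtP i (size p).+1) => [lt_ip|lt_pi|->]; last by left.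
    right; apply/mem_psums; exists i; last by rewrite take1.
    by move: lti; rewrite !size_cat /=; lia.
  right; apply/mem_psums; case: i lti lt_pi => // i lti lt_pi.
  exists i; last by rewrite take2.
  by move: lti; rewrite !size_cat /=; lia.
- by exists (size p).+1; rewrite // size_cat /=; lia.
case/mem_psums=> i lti ->; case: (leqP i (size p)) => [le_ip|lt_pi].
  by exists i; rewrite ?take1 //; move: lti; rewrite !size_cat /=; lia.
by exists i.+1; rewrite ?take2 //; move: lti; rewrite !size_cat /=; lia.
Qed.

Lemma reach_ind (P : seq nat -> Prop) c :
  P c -> (forall d e, P d -> e \in merges d -> P e) ->
  forall k d, d \in reach k c -> P d.
Proof.
move=> Pc PS k; elim: k c Pc => [|k IHk] c Pc d /=; first by rewrite inE => /eqP->.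
rewrite inE => /predU1P[-> //|/flattenP[_ /mapP[e ce ->]]].
by apply: IHk; apply: PS ce.
Qed.

(** Merging only removes partial sums. Conversely, merging [c] at a partial sum that [d] lacks
    preserves the inclusion and comes one step closer to [d]. *)
Lemma pcomp_leE c d : is_pcomp n c -> is_pcomp n d ->
  pcomp_le c d = (pset n d \subset pset n c).
Proof.
move=> c_comp d_comp; apply/idP/idP => [|sub_dc].
  apply: (reach_ind (P := fun e => pset n e \subset pset n c)) => // e f sub_e.
  case/mergesP=> p [a [b [q [De ->]]]]; apply: (subset_trans _ sub_e).
  by apply/subsetP=> x; rewrite De !inE merge_psums => ->; rewrite orbT.
(* Each merge shortens the list by one, so [(size e).-1] units of fuel suffice. *)
suff H k e : is_pcomp n e -> pset n d \subset pset n e ->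
    ((size e).-1 <= k)%N -> d \in reach k e.
  by apply: H => //; apply: leq_pred.
elim: k {c c_comp sub_dc}e => [|k IHk] c c_comp sub_dc le_ck.
  rewrite /= inE; apply/eqP; apply: (pset_inj d_comp c_comp); apply/eqP.
  by rewrite eqEcard sub_dc card_pset // (leq_trans le_ck).
have [->|neq_dc] := eqVneq d c; first by rewrite /= inE eqxx.
have /subsetPn[x] : ~~ (pset n c \subset pset n d).
  apply: contraNN neq_dc => sub_cd; apply/eqP/(pset_inj d_comp c_comp)/eqP.
  by rewrite eqEsubset sub_dc.
rewrite [x \in pset n c]inE [x \in pset n d]inE => /mem_psums[[|i] // lt_ic Dx] ndx.
have [p [a [b [q [Dc Dp]]]]] : exists p a b q,
    c = p ++ [:: a, b & q] /\ take i.+1 c = rcons p a.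
  exists (take i c), (nth 0%N c i), (nth 0%N c i.+1), (drop i.+2 c).
  by rewrite -!drop_nth ?cat_take_drop -?take_nth //; lia.
have e_comp : is_pcomp n (p ++ (a + b)%N :: q) by apply: merge_pcomp; rewrite -Dc.
rewrite /= inE; apply/orP; right; apply/flattenP.
exists (reach k (p ++ (a + b)%N :: q)).
  by apply/map_f/mergesP; exists p, a, b, q.
apply: IHk => //; last by move: le_ck; rewrite Dc !size_cat /=; lia.
apply/subsetP=> y dy; have := subsetP sub_dc y dy; rewrite !inE Dc merge_psums.
by rewrite -Dp -Dx => /predU1P[eq_yx|//]; rewrite inE eq_yx (negPf ndx) in dy.
Qed.

Lemma pcomp_le_type c d : is_pcomp n c -> pcomp_le c d ->
  pip_le n (pcomp_type c) (pcomp_type d).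
Proof.
move=> c_comp le_cd; suff [] : is_pcomp n d /\
  pip_le n (pcomp_type c) (pcomp_type d) by [].
apply: (reach_ind (P := fun e => is_pcomp n e /\
  pip_le n (pcomp_type c) (pcomp_type e))) le_cd; first by split=> //; apply: rt_refl.
move=> e f [e_comp le_ce] /mergesP[p [a [b [q [De ->]]]]].
rewrite De in e_comp le_ce; split; first exact: merge_pcomp.
by apply: rt_trans le_ce _; apply: merge_type.
Qed.

End CompOrder.
(** * Pointed set partitions *)

(** Every entry of [s] falls into exactly one class indexed by [r], so grouping neither loses nor
    repeats it. *)
Lemma perm_group (T1 T2 : eqType) (P : T1 -> pred T2) r s :
  {in s, forall y, count (P^~ y) r = 1%N} ->
  perm_eq (flatten [seq [seq y <- s | P x y] | x <- r]) s.
Proof.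
move=> P1; apply/seq.permP=> a.
rewrite count_flatten -map_comp sumnE big_map.
transitivity (\sum_(x <- r) \sum_(y <- s | a y) (P x y : nat))%N.
  by apply: eq_bigr => x _ /=; rewrite count_filter -sum1_count big_mkcondr.
rewrite exchange_big /= -sum1_count big_seq_cond [RHS]big_seq_cond.
apply: eq_bigr => y /andP[/P1 <- _].
by rewrite -sum1_count [RHS]big_mkcond.
Qed.

Section PspOrder.
Variable n : nat.
Implicit Types (p q x z : psp n) (B : {set 'I_n}).

Lemma psp_block_ex p B : is_psp p -> B \in p.1 -> exists i, i \in B.
Proof.
case/and3P=> _ _ p0 pB; apply/set0Pn.
by apply: contraNneq p0 => <-.
Qed.

Lemma psp_block_zero p B i : is_psp p -> B \in p.1 -> i \in B -> i \in p.2 = false.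
Proof.
move=> p_psp pB Bi; apply/negbTE.
rewrite -in_setC -(cover_partition p_psp); apply/bigcupP.
by exists B.
Qed.

Lemma psp_block_uniq p B B' i :
  is_psp p -> B \in p.1 -> B' \in p.1 -> i \in B -> i \in B' -> B = B'.
Proof.
case/and3P=> _ tI _ pB pB' Bi Bi'.
by rewrite -(def_pblock tI pB Bi) (def_pblock tI pB' Bi').
Qed.

Lemma psp_block_of p i : is_psp p -> i \notin p.2 -> exists2 B, B \in p.1 & i \in B.
Proof.
by move=> p_psp; rewrite -in_setC -(cover_partition p_psp) => /bigcupP.
Qed.

Lemma psp_leP p q : reflect
  (p.2 \subset q.2 /\
   forall B, B \in p.1 -> B \subset q.2 \/ exists2 B', B' \in q.1 & B \subset B')
  (psp_le p q).
Proof.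
apply: (iffP andP) => [[-> /forall_inP le_pq]|[-> le_pq]]; split=> //.
  by move=> B /le_pq /orP[->|/exists_inP]; [left | right].
by apply/forall_inP=> B /le_pq [->//|/exists_inP->]; rewrite orbT.
Qed.

Lemma psp_le_refl : reflexive (@psp_le n).
Proof. by move=> p; apply/psp_leP; split=> // B pB; right; exists B. Qed.

Lemma psp_le_trans : transitive (@psp_le n).
Proof.
move=> q p r /psp_leP[pq2 pq1] /psp_leP[qr2 qr1]; apply/psp_leP.
split=> [|B /pq1 [B_q|[B' /qr1 [B'_r|[B'' rB'' sB'']] sB']]].
- exact: subset_trans qr2.
- by left; apply: subset_trans qr2.
- by left; apply: subset_trans B'_r.
by right; exists B''; last apply: subset_trans sB''.
Qed.

Lemma psp_le_blocks p q : is_psp p -> is_psp q ->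
  psp_le p q -> psp_le q p -> p.1 \subset q.1.
Proof.
move=> p_psp q_psp /psp_leP[pq2 pq1] /psp_leP[qp2 qp1].
apply/subsetP=> B pB; have [i Bi] := psp_block_ex p_psp pB.
case: (pq1 B pB) => [/(subset_trans)/(_ qp2)/subsetP/(_ i Bi)|[B' qB' sB']].
  by rewrite (psp_block_zero p_psp pB Bi).
case: (qp1 B' qB') => [/(subset_trans sB')/subsetP/(_ i Bi)|[B'' pB'' sB'']].
  by rewrite (psp_block_zero p_psp pB Bi).
have Bi'' := subsetP sB'' i (subsetP sB' i Bi).
suff -> : B = B' by [].
apply/eqP; rewrite eqEsubset sB' /=.
by rewrite (psp_block_uniq p_psp pB pB'' Bi Bi'').
Qed.

Lemma psp_le_anti p q : is_psp p -> is_psp q -> psp_le p q -> psp_le q p -> p = q.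
Proof.
move=> p_psp q_psp pq qp.
rewrite [p]surjective_pairing [q]surjective_pairing; congr (_, _).
  by apply/eqP; rewrite eqEsubset !psp_le_blocks.
apply/eqP; rewrite eqEsubset.
by case/psp_leP: pq => -> _; case/psp_leP: qp => -> _.
Qed.

(** Group the blocks of [z] by the block of [x], or its zero block, that contains them; the sizes in
    a group add up, and [raw_le_coarsen] applies. *)
Lemma psp_le_type z x : is_psp z -> is_psp x -> psp_le z x ->
  pip_le n (psp_type z) (psp_type x).
Proof.
move=> z_psp x_psp /psp_leP[sub2 sub1].
have z_triv : trivIset z.1 by case/and3P: z_psp.
have block_zero B : B \in z.1 -> B \subset x.2 ->
    count (fun B' => B \subset B') (enum x.1) = 0%N.
  move=> zB sB; have [i Bi] := psp_block_ex z_psp zB.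
  apply/eqP; rewrite -leqn0 leqNgt -has_count; apply/hasPn=> B'.
  rewrite mem_enum => xB'; apply/negP=> /subsetP/(_ i Bi) Bi'.
  by have := psp_block_zero x_psp xB' Bi'; rewrite (subsetP sB).
(* The zero block of [x] heads the list as one more possible container. *)
have grp : {in enum z.1, forall B,
    count (fun B' => B \subset B') (x.2 :: enum x.1) = 1%N}.
  move=> B; rewrite mem_enum => zB /=; have [i Bi] := psp_block_ex z_psp zB.
  case: (sub1 B zB) => [sB|[B' xB' sB']]; first by rewrite sB block_zero.
  have -> : B \subset x.2 = false.
    apply/negP=> /subsetP/(_ i Bi).
    by rewrite (psp_block_zero x_psp xB') ?(subsetP sB').
  rewrite (eq_in_count (a2 := pred1 B')).
    by rewrite count_uniq_mem ?enum_uniq ?mem_enum ?xB'.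
  move=> B'' /=; rewrite mem_enum => xB''; apply/idP/eqP => [sB''|-> //].
  by apply: (psp_block_uniq x_psp xB'' xB' (i := i));
     rewrite ?(subsetP sB'') ?(subsetP sB').
have {grp} := perm_group grp; rewrite /= -[_ ++ _]/(flatten (_ :: _)).
set G := fun C : {set 'I_n} => filter (fun B : {set 'I_n} => B \subset C) (enum z.1).
move=> grp; pose szs := map (fun B : {set 'I_n} => #|B|).
have sumG C : sumn (szs (G C)) = #|cover [set B in z.1 | B \subset C]|.
  rewrite sumnE big_map /G big_filter big_enum_cond /=.
  have /eqP <- : trivIset [set B in z.1 | B \subset C].
    by apply: trivIsetS z_triv; apply/subsetP=> B; rewrite inE => /andP[].
  by apply: eq_bigl => B; rewrite inE.
have sum_block C : C \in x.1 -> sumn (szs (G C)) = #|C|.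
  move=> xC; rewrite sumG; apply: eq_card => i; apply/bigcupP/idP => [[B]|Ci].
    by rewrite inE => /andP[_ /subsetP sB] /sB.
  have /(psp_block_of z_psp)[B zB Bi] : i \notin z.2.
    by apply: contraFN (psp_block_zero x_psp xC Ci) => /(subsetP sub2).
  exists B => //; rewrite inE zB /=.
  case: (sub1 B zB) => [/subsetP/(_ i Bi)|[B' xB' sB']].
    by rewrite (psp_block_zero x_psp xC Ci).
  by rewrite (psp_block_uniq x_psp xC xB' Ci) ?(subsetP sB').
have sum_zero : (sumn (szs (G x.2)) + #|z.2|)%N = #|x.2|.
  rewrite sumG -[#|x.2|](cardsID z.2) addnC (setIidPr sub2); congr (_ + _)%N.
  apply: eq_card => i; rewrite inE; apply/bigcupP/andP => [[B]|[nzi xi]].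
    rewrite inE => /andP[zB /subsetP sB] Bi.
    by rewrite (psp_block_zero z_psp zB Bi) sB.
  have [B zB Bi] := psp_block_of z_psp nzi.
  exists B => //; rewrite inE zB /=.
  case: (sub1 B zB) => [//|[B' xB' sB']].
  by have := psp_block_zero x_psp xB' (subsetP sB' i Bi); rewrite xi.
have -> : psp_type x = (canon (map sumn (map (szs \o G) (enum x.1))),
                       (sumn (szs (G x.2)) + #|z.2|)%N).
  rewrite /psp_type sum_zero; congr (canon _, _); rewrite -map_comp.
  by apply/eq_in_map => C; rewrite mem_enum => xC; rewrite /= sum_block.
have perm_z : perm_eq (szs (G x.2) ++ flatten (map (szs \o G) (enum x.1)))
    (map (fun B : {set 'I_n} => #|B|) (enum z.1)).
  rewrite map_comp -map_flatten -map_cat; exact: perm_map.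
apply: (raw_le_perm _ (perm_refl _)); first exact: perm_z.
apply: raw_le_coarsen.
- apply/allP=> t /mapP[C]; rewrite mem_enum => xC ->.
  have [i Ci] := psp_block_ex x_psp xC.
  apply/eqP=> /(congr1 sumn); rewrite /= sum_block // => /cards0_eq C0.
  by rewrite C0 inE in Ci.
- rewrite (perm_all _ perm_z); apply/allP=> k /mapP[B]; rewrite mem_enum => zB ->.
  by rewrite card_gt0; apply/set0Pn; apply: psp_block_ex zB.
rewrite (perm_sumn perm_z) sumnE big_map big_enum /= -(card_partition z_psp).
by rewrite addnC cardsC card_ord.
Qed.

End PspOrder.
(* An ordered pointed set partition with [m] nonzero blocks is a word
   [w : {ffun 'I_n -> 'I_m.+1}] hitting every value except possibly [ord_max],
   whose fibre is the zero block. *)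
Section Words.
Variables n m : nat.
Implicit Types (w : {ffun 'I_n -> 'I_m.+1}) (z x : psp n) (j : 'I_m.+1).

Definition onto w := [forall j, (j != ord_max) ==> [exists i, w i == j]].

Definition fib w j : {set 'I_n} := [set i | w i == j].

Definition word_psp w : psp n := (fib w @: [set~ ord_max], fib w ord_max).

Lemma ontoP w : reflect (forall j, j != ord_max -> exists i, w i = j) (onto w).
Proof.
apply: (iffP forall_inP) => w_onto j /w_onto; first by case/existsP=> i /eqP; exists i.
by case=> i <-; apply/existsP; exists i.
Qed.

Lemma onto_le w : onto w -> (m <= n)%N.
Proof.
move=> /ontoP w_onto; rewrite -[m]/(m.+1.-1) -[m.+1]card_ord -(cardsC1 ord_max).
apply: leq_trans (_ : #|w @: [set: 'I_n]| <= _)%N; last first.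
  by rewrite (leq_trans (leq_imset_card _ _)) // cardsT card_ord.
apply/subset_leq_card/subsetP=> j; rewrite !inE => /w_onto[i <-].
exact: imset_f.
Qed.

Lemma fib_inj w : onto w -> {in [set~ ord_max] &, injective (fib w)}.
Proof.
move=> /ontoP w_onto j j'; rewrite !inE => /w_onto[i wi] _ /setP/(_ i).
by rewrite !inE wi eqxx => /esym/eqP.
Qed.

Lemma word_psp_valid w : onto w -> is_psp (word_psp w).
Proof.
move=> w_onto; apply/and3P; split.
- apply/eqP/setP=> i; rewrite !inE; apply/bigcupP/idP => [[_ /imsetP[j + ->]]|wi].
    by rewrite !inE => j_max /eqP->.
  by exists (fib w (w i)); rewrite ?inE //; apply/imset_f; rewrite !inE.
- apply/trivIsetP=> _ _ /imsetP[j _ ->] /imsetP[j' _ ->] neq.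
  rewrite -setI_eq0; apply: contraNT neq => /set0Pn[i].
  by rewrite !inE => /andP[/eqP-> /eqP->].
apply/imsetP=> -[j]; rewrite !inE => /(ontoP _ w_onto)[i wi] /setP/(_ i).
by rewrite !inE wi eqxx.
Qed.

Lemma card_word_psp w : onto w -> #|(word_psp w).1| = m.
Proof.
by move=> w_onto; rewrite card_in_imset ?cardsC1 ?card_ord //; apply: fib_inj.
Qed.

(** The relation [psp_le z (word_psp w)] read letter by letter, a form easy to check when letters
    are shifted. *)
Definition compat z w :=
  [forall i in z.2, w i == ord_max] &&
  [forall B in z.1, forall i in B, forall i' in B, w i == w i'].

Lemma compatP z w : reflect
  ((forall i, i \in z.2 -> w i = ord_max) /\
   (forall B i i', B \in z.1 -> i \in B -> i' \in B -> w i = w i'))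
  (compat z w).
Proof.
apply: (iffP andP) => [[/forall_inP w2 /forall_inP w1]|[w2 w1]]; split.
- by move=> i /w2/eqP.
- by move=> B i i' /w1/forall_inP + Bi Bi' => /(_ i Bi)/forall_inP/(_ i' Bi')/eqP.
- by apply/forall_inP=> i /w2->.
apply/forall_inP=> B zB; apply/forall_inP=> i Bi; apply/forall_inP=> i' Bi'.
by rewrite (w1 B i i').
Qed.

Lemma psp_le_word z w : is_psp z -> psp_le z (word_psp w) = compat z w.
Proof.
move=> z_psp; apply/psp_leP/compatP=> [[w2 w1]|[w2 w1]]; split.
- by move=> i /(subsetP w2); rewrite inE => /eqP.
- move=> B i i' zB Bi Bi'; case: (w1 B zB) => [|[_ /imsetP[j _ ->]]] /subsetP sB.
    by move: (sB i Bi) (sB i' Bi'); rewrite !inE => /eqP-> /eqP->.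
  by move: (sB i Bi) (sB i' Bi'); rewrite !inE => /eqP-> /eqP->.
- by apply/subsetP=> i /w2; rewrite inE => ->.
move=> B zB; have [i Bi] := psp_block_ex z_psp zB.
have sB : B \subset fib w (w i).
  by apply/subsetP=> i' Bi'; rewrite inE (w1 B i' i).
have [wi|wi] := eqVneq (w i) ord_max; first by left; rewrite /= -wi.
by right; exists (fib w (w i)) => //; apply/imset_f; rewrite !inE.
Qed.

Section Fibre.
Variable x : psp n.
Hypothesis x_psp : is_psp x.
Hypothesis x_card : #|x.1| = m.
Let T := {B : {set 'I_n} | B \in x.1}.

(** Outside the blocks [pblock] returns the empty set, which is no block, so [insub] fails and the
    letter is [ord_max]; [lift ord_max] keeps the labels of blocks away from it. *)
Definition label (f : {ffun T -> 'I_m}) : {ffun 'I_n -> 'I_m.+1} :=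
  [ffun i => if insub (pblock x.1 i) is Some B then lift ord_max (f B) else ord_max].

Lemma label_block f (B : T) i : i \in val B -> label f i = lift ord_max (f B).
Proof.
case/and3P: (x_psp) => _ tI _ Bi; rewrite ffunE (def_pblock tI (valP B) Bi).
by rewrite valK.
Qed.

Lemma label_zero f i : i \in x.2 -> label f i = ord_max.
Proof.
move=> xi; rewrite ffunE /pblock; case: pickP => [C /andP[xC Ci]|_] /=.
  by rewrite (psp_block_zero x_psp xC Ci) in xi.
case: insubP => // B x0 _; have [i'] := psp_block_ex x_psp x0.
by rewrite inE.
Qed.

Lemma block_elt (B : T) : exists i, i \in val B.
Proof. exact: psp_block_ex x_psp (valP B). Qed.

Lemma label_inj : injective label.
Proof.
move=> f g eq_fg; apply/ffunP=> B; have [i Bi] := block_elt B.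
by have /ffunP/(_ i) := eq_fg; rewrite !(label_block _ Bi) => /lift_inj.
Qed.

Lemma word_psp_label (f : {ffun T -> 'I_m}) : injective f ->
  onto (label f) /\ word_psp (label f) = x.
Proof.
move=> f_inj.
have f_onto k : exists B, f B = k.
  have /codomP[B ->] : k \in codom f.
    by apply: inj_card_onto; rewrite // card_ord card_sig x_card.
  by exists B.
have fibE B : fib (label f) (lift ord_max (f B)) = val B.
  apply/setP=> i; rewrite inE; apply/eqP/idP => [|/label_block->//].
  have [xi|/(psp_block_of x_psp)[C xC Ci]] := boolP (i \in x.2).
    by rewrite label_zero // => /eqP; rewrite (negPf (neq_lift _ _)).
  by rewrite (label_block f (B := Sub C xC)) // => /lift_inj/f_inj <-.
split.
  apply/ontoP=> j; case: (unliftP ord_max j) => [k -> _|->]; last by rewrite eqxx.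
  have [B <-] := f_onto k; have [i Bi] := block_elt B.
  by exists i; apply: label_block.
rewrite [RHS]surjective_pairing; congr (_, _).
  apply/setP=> B; apply/imsetP/idP => [[j]|xB].
    rewrite !inE; case: (unliftP ord_max j) => [k -> _ ->|->]; last by rewrite eqxx.
    by have [C <-] := f_onto k; rewrite fibE (valP C).
  exists (lift ord_max (f (Sub B xB))); first by rewrite !inE eq_sym neq_lift.
  by rewrite fibE.
apply/setP=> i; rewrite inE; apply/eqP/idP => [|/label_zero->//].
apply: contraPT => /(psp_block_of x_psp)[B xB Bi].
rewrite (label_block f (B := Sub B xB)) //; apply/eqP.
by rewrite eq_sym neq_lift.
Qed.

Lemma word_psp_labelE w : onto w -> word_psp w = x ->
  exists2 f : {ffun T -> 'I_m}, injective f & w = label f.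
Proof.
move=> w_onto Dx.
have /fin_all_exists[f Df] (B : T) :
    exists k : 'I_m, val B = fib w (lift ord_max k).
  have : val B \in (word_psp w).1 by rewrite Dx (valP B).
  case/imsetP=> j.
  rewrite !inE; case: (unliftP ord_max j) => [k -> _|->]; last by rewrite eqxx.
  by exists k.
exists (finfun f) => [B C|].
  by rewrite !ffunE => eqBC; apply: val_inj; rewrite !Df eqBC.
apply/ffunP=> i; have [xi|/(psp_block_of x_psp)[B xB Bi]] := boolP (i \in x.2).
  by rewrite label_zero //; apply/eqP; rewrite -Dx inE in xi.
rewrite (label_block _ (B := Sub B xB)) // ffunE; apply/eqP.
by have := Df (Sub B xB); rewrite /= => /setP/(_ i); rewrite Bi inE.
Qed.

(** The words of [x] are the injective labellings of its [m] blocks by [m] labels. *)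
Lemma card_words_eq : #|[set w | onto w && (word_psp w == x)]| = m`!.
Proof.
have -> : [set w | onto w && (word_psp w == x)] =
          label @: [set f : {ffun T -> 'I_m} | injectiveb f].
  apply/setP=> w; rewrite inE; apply/andP/imsetP.
    move=> [w_onto /eqP/(word_psp_labelE w_onto)[f f_inj ->]].
    by exists f => //; rewrite inE; apply/injectiveP.
  case=> f; rewrite inE => /injectiveP/word_psp_label[f_onto Df] ->.
  by rewrite f_onto Df eqxx.
rewrite card_imset; last exact: label_inj.
by rewrite card_inj_ffuns card_ord card_sig x_card ffactnn.
Qed.

End Fibre.

Lemma card_words x : is_psp x ->
  #|[set w | onto w && (word_psp w == x)]| = (if m == #|x.1| then m`! else 0)%N.
Proof.
move=> x_psp; case: eqP => [/esym|neq]; first exact: card_words_eq.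
apply: eq_card0 => w; rewrite inE; apply/andP=> -[w_onto /eqP Dx].
by apply: neq; rewrite -Dx card_word_psp.
Qed.

End Words.

(** * Signed counts of words and their cancellation *)

Section AlternatingWords.
Variable n : nat.
Implicit Types (z x : psp n).

Lemma card_psp_le x : is_psp x -> (#|x.1| <= n)%N.
Proof.
move=> x_psp; apply: leq_trans (_ : #|~: x.2| <= n)%N; last first.
  by rewrite -[leqRHS]card_ord max_card.
rewrite (card_partition x_psp) -sum1_card; apply: leq_sum => B xB.
by have [i Bi] := psp_block_ex x_psp xB; rewrite card_gt0; apply/set0Pn; exists i.
Qed.

Definition words (P : pred (psp n)) m : {set {ffun 'I_n -> 'I_m.+1}} :=
  [set w | onto w && P (word_psp w)].

(** The factorial is the number of words of [x]; grouping words by [word_psp] leaves a signed count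
    by alphabet size, bounded because there are at most [n] blocks. *)
Lemma psp_sum_words (P : pred (psp n)) :
  \sum_(x | is_psp x && P x) (-1) ^+ #|x.1| * (#|x.1|`!)%:Z =
  \sum_(m < n.+1) (-1) ^+ m * #|words P m|%:Z :> int.
Proof.
transitivity (\sum_(m < n.+1) \sum_(x | is_psp x && P x)
   (-1) ^+ m * #|[set w : {ffun 'I_n -> 'I_m.+1} | onto w && (word_psp w == x)]|%:Z).
  rewrite exchange_big; apply: eq_bigr => x /andP[x_psp _].
  have lt_x : (#|x.1| < n.+1)%N by rewrite ltnS card_psp_le.
  rewrite (bigD1 (Ordinal lt_x)) //= card_words // eqxx big1 ?addr0 // => m.
  by rewrite -val_eqE /= => /negPf neq_m; rewrite card_words // neq_m mulr0.
apply: eq_bigr => m _; rewrite -mulr_sumr; congr (_ * _).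
have -> : #|words P m| = (\sum_(x | is_psp x && P x)
    #|[set w : {ffun 'I_n -> 'I_m.+1} | onto w && (word_psp w == x)]|)%N.
  rewrite -sum1dep_card (partition_big (@word_psp n m) (fun x => is_psp x && P x)).
    apply: eq_bigr => x /andP[_ Px]; rewrite -sum1dep_card.
    by apply: eq_bigl => w; case: eqP => [->|]; rewrite ?Px ?andbT ?andbF.
  by move=> w /andP[/word_psp_valid-> ->].
by rewrite -natz natr_sum; apply: eq_bigr => x _; rewrite natz.
Qed.

Section Involution.
Variables (z : psp n) (B0 : {set 'I_n}) (b : 'I_n).
Hypotheses (z_psp : is_psp z) (zB0 : B0 \in z.1) (B0b : b \in B0).

(** For a word compatible with [z] this makes [B0] a whole nonzero fibre. *)
Definition isolated m (w : {ffun 'I_n -> 'I_m.+1}) :=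
  (w b != ord_max) && (fib w (w b) \subset B0).

(** [B0] keeps its letter [v], while elsewhere all letters from [v] on move up by one, so the rest
    of the old fibre follows directly as letter [v + 1]. Out of the zero block, [B0] becomes the
    last nonzero block. *)
Definition isolate m (w : {ffun 'I_n -> 'I_m.+1}) : {ffun 'I_n -> 'I_m.+2} :=
  [ffun i => let v := widen_ord (leqnSn _) (w b) in
             if i \in B0 then v else lift v (w i)].

Lemma isolate_in m (w : {ffun 'I_n -> 'I_m.+1}) i :
  i \in B0 -> isolate w i = w b :> nat.
Proof. by move=> B0i; rewrite ffunE B0i. Qed.

Lemma isolate_out m (w : {ffun 'I_n -> 'I_m.+1}) i :
  i \notin B0 -> isolate w i = bump (w b) (w i) :> nat.
Proof. by move=> /negPf B0i; rewrite ffunE B0i. Qed.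

Lemma isolate_inj m : {in [pred w | compat z w] &, injective (@isolate m)}.
Proof.
move=> w w'; rewrite !inE => /compatP[_ w1] /compatP[_ w1'] eq_ww'.
have eq_b : w b = w' b.
  by apply: val_inj; rewrite /= -(isolate_in w B0b) eq_ww' isolate_in.
apply/ffunP=> i; have [B0i|B0i] := boolP (i \in B0).
  by rewrite (w1 B0 i b) // (w1' B0 i b).
apply: val_inj; apply: (can_inj (bumpK (w b))); rewrite /=.
by rewrite -isolate_out // eq_ww' isolate_out // eq_b.
Qed.

(** [isolate] is inverted by merging the letter of [b] with the next one. *)
Lemma card_isolated m :
  #|[set w : {ffun 'I_n -> 'I_m.+2} | [&& onto w, compat z w & isolated w]]| =
  #|[set w : {ffun 'I_n -> 'I_m.+1} | [&& onto w, compat z w & ~~ isolated w]]|.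
Proof.
rewrite -(card_in_imset (f := @isolate m)); last first.
  by move=> w w'; rewrite !inE => /and3P[_ ? _] /and3P[_ ? _]; apply: isolate_inj.
apply: eq_card => w'; apply/idP/imsetP; last first.
  case=> w; rewrite inE => /and3P[/ontoP w_onto /compatP[w2 w1] w_iso] ->.
  have wb := ltn_ord (w b); rewrite inE; apply/and3P; split.
  - apply/ontoP=> k k_max; have lt_k : (k < m.+1)%N.
      by move: k_max (ltn_ord k); rewrite -val_eqE /=; lia.
    have [eq_k|neq_k] := eqVneq (k : nat) (w b).
      by exists b; apply: val_inj; rewrite /= isolate_in.
    have lt_k' : (unbump (w b) k < m)%N by rewrite /unbump; lia.
    pose k' : 'I_m.+1 := widen_ord (leqnSn _) (Ordinal lt_k').
    (* If [k'] is met inside [B0], it is the letter of [b]; as [w] is not isolated, that fibre also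
       has an element outside [B0]. *)
    have [i B0i wi] : exists2 i, i \notin B0 & w i = k'.
      have [i wi] : exists i, w i = k'.
        by apply: w_onto; rewrite -val_eqE /= neq_ltn lt_k'.
      have [B0i|] := boolP (i \in B0); last by exists i.
      have Dk' : w b = k' by rewrite -wi (w1 B0 b i).
      move: w_iso; rewrite /isolated Dk' -{1}Dk' negb_and negbK Dk'.
      case/orP=> [/eqP/(congr1 val) /= E|/subsetPn[i']].
        by move: (lt_k'); rewrite E ltnn.
      by rewrite inE => /eqP; exists i'.
    exists i; apply: val_inj; rewrite /= isolate_out // wi /= unbumpKcond.
    by rewrite (negPf neq_k).
  - apply/compatP; split=> [i zi|B i i' zB Bi Bi'].
      have B0i : i \notin B0.
        by apply: contraTN zi => B0i; rewrite (psp_block_zero z_psp zB0 B0i).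
      by apply: val_inj; rewrite /= isolate_out // (w2 i) //= /bump -ltnS wb.
    have [eqB|neqB] := eqVneq B B0.
      by rewrite eqB in Bi Bi'; apply: val_inj; rewrite /= !isolate_in.
    have outB j : j \in B -> j \notin B0.
      by move=> Bj; apply: contra_neqN neqB => /(psp_block_uniq z_psp zB zB0 Bj).
    by apply: val_inj; rewrite /= !isolate_out ?outB // (w1 B i i').
  apply/andP; split; first by rewrite -val_eqE /= isolate_in // neq_ltn wb.
  apply/subsetP=> i; rewrite inE -val_eqE /= (isolate_in w B0b).
  by apply: contraLR => /isolate_out->; rewrite eq_sym neq_bump.
rewrite inE => /and3P[/ontoP w_onto /compatP[w2 w1] /andP[wb_max /subsetP wb_B0]].
have lt_wb : (w' b < m.+1)%N.
  by move: wb_max (ltn_ord (w' b)); rewrite -val_eqE /=; lia.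
have lt_w i : (unbump (w' b) (w' i) < m.+1)%N.
  by have := ltn_ord (w' i); rewrite /unbump; lia.
(* Lowering all letters above [w' b] by one merges [w' b] with its successor. *)
pose w : {ffun 'I_n -> 'I_m.+1} := [ffun i => Ordinal (lt_w i)].
have wE i : w i = unbump (w' b) (w' i) :> nat by rewrite ffunE.
have w_b : w b = w' b :> nat by rewrite wE /unbump ltnn subn0.
have w_out i : i \notin B0 -> w' i != w' b.
  by apply: contraNneq => wi; apply: wb_B0; rewrite inE wi.
exists w; last first.
  apply/ffunP=> i; apply: val_inj => /=; have [B0i|B0i] := boolP (i \in B0).
    by rewrite isolate_in // w_b (w1 B0 i b).
  rewrite isolate_out // w_b wE unbumpK // inE /=.
  by have := w_out i B0i; rewrite -val_eqE.
rewrite inE; apply/and3P; split.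
- apply/ontoP=> k k_max; have lt_k : (k < m)%N.
    by rewrite ltn_neqAle k_max -ltnS /=.
  have lt_k' : (bump (w' b) k < m.+1)%N by rewrite /bump; lia.
  have [i wi] : exists i, w' i = widen_ord (leqnSn _) (Ordinal lt_k').
    by apply: w_onto; rewrite -val_eqE /= neq_ltn lt_k'.
  by exists i; apply: val_inj; rewrite /= wE wi /= bumpK.
- apply/compatP; split=> [i /w2 wi|B i i' zB Bi Bi'].
    by apply: val_inj; rewrite /= wE wi /unbump /= lt_wb subn1.
  by apply: val_inj; rewrite /= !wE (w1 B i i').
(* Were the merged word isolated, the letter [(w' b).+1] would not be the last and would occur in
   [w']; its occurrences would lie in [B0], where [w'] only has the letter [w' b]. *)
apply/negP=> /andP[wb_max' /subsetP w_B0].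
have lt_v : (w' b < m)%N by rewrite ltn_neqAle -ltnS lt_wb andbT -w_b.
have [i wi] : exists i, w' i = inord (w' b).+1.
  by apply: w_onto; rewrite -val_eqE /= inordK ?neq_ltn ltnS // lt_v.
have /w_B0 B0i : i \in fib w (w b).
  rewrite inE -val_eqE /= wE w_b wi inordK; last lia.
  by rewrite /unbump leqnn subSS subn0.
have := congr1 val wi; rewrite (w1 B0 i b) //= inordK ?ltnS //.
by move/eqP; rewrite ltn_eqF.
Qed.
End Involution.

(* Splitting [B0] off as a block of its own changes the sign, so the words with
   [B0] isolated cancel the other ones. *)
Lemma words_above_sum z : is_psp z -> z.1 != set0 ->
  \sum_(m < n.+1) (-1) ^+ m * #|words (psp_le z) m|%:Z = 0 :> int.
Proof.
move=> z_psp /set0Pn[B0 zB0]; have [b B0b] := psp_block_ex z_psp zB0.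
pose a m := #|[set w : {ffun 'I_n -> 'I_m.+1} |
                 [&& onto w, compat z w & isolated B0 b w]]|.
have a0 : a 0%N = 0%N.
  by apply: eq_card0 => w; rewrite inE /isolated [w b]ord1 [ord_max]ord1 eqxx !andbF.
have card_m m : #|words (psp_le z) m| = (a m + a m.+1)%N.
  rewrite /a (card_isolated z_psp zB0 B0b).
  rewrite -(cardsID [set w | isolated B0 b w] (words _ _)).
  by congr (_ + _)%N; apply: eq_card => w; rewrite !inE psp_le_word //;
     case: (onto w); case: (compat z w); case: (isolated B0 b w).
(* The sum telescopes to its last term, which vanishes since [n.+1] nonzero letters cannot all
   occur. *)
have sumE k : \sum_(m < k) (-1) ^+ m * #|words (psp_le z) m|%:Z
    = - ((-1) ^+ k * (a k)%:Z) :> int.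
  elim: k => [|k IHk]; first by rewrite big_ord0 a0 mulr0 oppr0.
  rewrite big_ord_recr /= IHk card_m PoszD mulrDr exprS.
  by rewrite mulN1r mulNr opprK addKr.
rewrite sumE; suff -> : a n.+1 = 0%N by rewrite mulr0 oppr0.
apply: eq_card0 => w; rewrite inE; apply/negbTE/andP => -[/onto_le].
by rewrite ltnn.
Qed.

End AlternatingWords.
(** * Words and descents *)

(** In an increasing list the entries at most [p] form a prefix. *)
Lemma count_leq_sorted (l : seq nat) p j : sorted ltn l -> (j < size l)%N ->
  (j < count (leq^~ p) l)%N = (nth 0 l j <= p)%N.
Proof.
elim: l j => // x l IHl j x_l lt_j; have l_sorted := path_sorted x_l.
have /allP lt_xl := order_path_min ltn_trans x_l.
case: (leqP x p) => [le_xp|lt_px].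
  by case: j lt_j => [|j] lt_j /=; rewrite le_xp add1n ?ltnS // IHl.
have -> : count (leq^~ p) (x :: l) = 0%N.
  apply/eqP; rewrite -leqn0 leqNgt -has_count; apply/hasPn=> y.
  by rewrite -ltnNge inE => /predU1P[-> //|/lt_xl]; apply: ltn_trans.
rewrite ltn0; apply/esym/negbTE; rewrite -ltnNge; case: j lt_j => //= j lt_j.
by apply: ltn_trans lt_px _; apply/lt_xl/mem_nth.
Qed.

Lemma card_ord_lt n k : (k <= n)%N -> #|[set q : 'I_n | (q < k)%N]| = k.
Proof.
move=> le_kn; rewrite -sum1_card (eq_bigl (fun q : 'I_n => (q < k)%N)).
  by rewrite -(big_ord_widen n (fun=> 1%N)) // sum1_card card_ord.
by move=> q; rewrite inE.
Qed.

Lemma nth_psums c j : (j < (size c).-1)%N -> nth 0%N (psums c) j = sumn (take j.+1 c).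
Proof. by move=> lt_j; rewrite (nth_map 0%N) ?size_iota // nth_iota. Qed.

Section Content.
Variables n m : nat.
Implicit Type w : {ffun 'I_n -> 'I_m.+1}.

Definition content w : seq nat := [seq #|fib w j| | j <- enum 'I_m.+1].

Lemma size_content w : size (content w) = m.+1.
Proof. by rewrite size_map size_enum_ord. Qed.

Lemma sumn_take_content w k : (k <= m.+1)%N ->
  sumn (take k (content w)) = #|[set i | (w i < k)%N]|.
Proof.
elim: k => [|k IHk] le_k; first by rewrite take0 eq_card0 // => i; rewrite inE.
rewrite (take_nth 0%N) ?size_content // sumn_rcons IHk ?(ltnW le_k) //.
rewrite (nth_map ord0) ?size_enum_ord //.
rewrite -(cardsID [set i | (w i < k)%N] [set i | (w i < k.+1)%N]).
congr (_ + _)%N; apply: eq_card => i; rewrite !inE ltnS; first by case: ltngtP.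
by rewrite -val_eqE /= nth_enum_ord //; case: ltngtP.
Qed.

Lemma sumn_content w : sumn (content w) = n.
Proof.
rewrite -[content w](@take_oversize _ m.+1) ?size_content // sumn_take_content //.
by rewrite -[RHS](card_ord n); apply: eq_card => i; rewrite inE ltn_ord.
Qed.

Let widen (j : 'I_m) : 'I_m.+1 := widen_ord (leqnSn m) j.

Lemma contentE w :
  content w = rcons [seq #|fib w (widen j)| | j <- enum 'I_m] #|fib w ord_max|.
Proof. by rewrite /content enum_ordSr map_rcons -map_comp. Qed.

Lemma widenP (j : 'I_m.+1) : j != ord_max -> exists k, j = widen k.
Proof.
move=> j_max; have lt_j : (j < m)%N.
  by rewrite ltn_neqAle -ltnS ltn_ord andbT.
by exists (Ordinal lt_j); apply: val_inj.
Qed.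

Lemma widen_neq_max k : widen k != ord_max.
Proof. by rewrite -val_eqE /= neq_ltn ltn_ord. Qed.

(** Hitting every letter but [ord_max] means that all multiplicities but the last, the size of the
    zero block, are positive. *)
Lemma content_pcomp w : is_pcomp n (content w) = onto w.
Proof.
rewrite /is_pcomp size_content sumn_content eqxx andbT contentE init_rcons /=.
rewrite all_map; apply/allP/ontoP => [w_pos j /widenP[k ->]|w_onto k _ /=].
  have := w_pos k; rewrite mem_enum => /(_ isT) /=; rewrite card_gt0.
  by case/set0Pn=> i; rewrite inE => /eqP; exists i.
have [i wi] := w_onto _ (widen_neq_max k).
by rewrite card_gt0; apply/set0Pn; exists i; rewrite inE wi.
Qed.

Lemma content_type w : onto w -> pcomp_type (content w) = psp_type (word_psp w).
Proof.
move=> w_onto; rewrite /pcomp_type contentE init_rcons last_rcons.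
congr (_, _); apply/canonP.
rewrite (map_comp (fun B : {set 'I_n} => #|B|) (fun j => fib w (widen j))).
apply/perm_map/uniq_perm; rewrite ?enum_uniq //.
  rewrite map_inj_uniq ?enum_uniq // => j k /(fib_inj w_onto).
  by rewrite !inE !widen_neq_max => /(_ isT isT)/(congr1 val)/= /val_inj.
move=> B; rewrite mem_enum; apply/mapP/imsetP => [[k _ ->]|[j]].
  by exists (widen k); rewrite // !inE widen_neq_max.
by rewrite !inE => /widenP[k ->] ->; exists k; rewrite ?mem_enum.
Qed.

End Content.

(** * Descent sets and a uniform formula for [beta] *)

Section Descents.
Variable n : nat.
Implicit Type s : 'S_n.

Definition desc s : {set 'I_n} := [set a : 'I_n | a.+1 \in descents s].

Lemma mem_descents s k : k \in descents s ->
  exists a a' : 'I_n, [/\ k = a.+1, a' = a.+1 :> nat & (s a' < s a)%N].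
Proof.
case/mapP=> i; rewrite mem_filter mem_iota /= => /andP[+ lt_i] ->.
have lt_in : (i < n)%N by lia.
have lt_i1 : (i.+1 < n)%N by lia.
have nthE (a : 'I_n) : nth 0%N [seq val (s j) | j <- enum 'I_n] a = s a.
  by rewrite (nth_map a) ?size_enum_ord // nth_ord_enum.
rewrite -[i]/(val (Ordinal lt_in)) -[i.+1]/(val (Ordinal lt_i1)) !nthE => lt_s.
by exists (Ordinal lt_in), (Ordinal lt_i1).
Qed.

Lemma descP s (a : 'I_n) :
  reflect (exists2 a' : 'I_n, a' = a.+1 :> nat & (s a' < s a)%N) (a \in desc s).
Proof.
rewrite inE; apply: (iffP idP) => [/mem_descents[b [a' [[/ord_inj->]]]]|].
  by exists a'.
case=> a' Da' lt_s; apply/map_f; rewrite mem_filter mem_iota.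
have nthE (b : 'I_n) : nth 0%N [seq val (s j) | j <- enum 'I_n] b = s b.
  by rewrite (nth_map b) ?size_enum_ord // nth_ord_enum.
by rewrite -Da' !nthE lt_s /=; have := ltn_ord a'; lia.
Qed.

(** The conventions agree with the count: [[:: 0]] leaves only the empty permutation, and a final 0
    in a longer list makes [n] a partial sum, where no descent can occur. *)
Lemma betaE c : is_pcomp n c -> beta n c = #|[set s | desc s == pset n c]|.
Proof.
move=> c_comp; case/and3P: (c_comp) => c_gt0 c_pos /eqP c_sum.
rewrite /beta; case: eqP => [Dc|neq0].
  have n0 : n = 0%N by rewrite -c_sum Dc.
  rewrite -[1%N]/(0`!) -n0 -card_Sn; apply: eq_card => s; rewrite !inE.
  by apply/esym/eqP/setP=> -[i lt_i]; exfalso; rewrite n0 in lt_i.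
case: eqP => [last0|_].
  have Dc := init_last c_gt0; rewrite last0 in Dc.
  have sum_init : sumn (init c) = n by rewrite -c_sum [in RHS]Dc sumn_rcons addn0.
  have n_gt0 : (0 < n)%N.
    case: (init c) Dc c_pos sum_init => [/neq0//|x t _ /andP[x_gt0 _] <-].
    by rewrite addn_gt0 x_gt0.
  (* The point [n.-1] of [pset] stands for the partial sum [n]. *)
  have lt_n : (n.-1 < n)%N by rewrite prednK.
  apply/esym/eq_card0 => s; rewrite !inE; apply/negP=> /eqP/setP/(_ (Ordinal lt_n)).
  rewrite [in RHS]inE /= prednK //; have -> : n \in psums c.
    apply/mem_psums; exists (size (init c)).
      rewrite {2}size_init prednK // leqnn andbT lt0n size_eq0.
      by apply: contraTneq n_gt0 => init0; rewrite -sum_init init0.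
    by rewrite -{1}sum_init; congr sumn; rewrite [X in take _ X]Dc -cats1 take_size_cat.
  by case/descP=> a' /= Da'; have := ltn_ord a'; rewrite Da' prednK // ltnn.
have pos_psums x : x \in psums c -> (0 < x)%N by case/(psums_bound c_comp)/andP.
apply: eq_card => s; rewrite !inE; apply/forallP/eqP => [eq_s|/setP eq_s [[|k] lt_k]].
- apply/setP=> a; rewrite !inE; apply/eqP.
  apply: (eq_s (Ordinal (ltn_ord a : a.+1 < n.+1)%N)).
- apply/eqP; transitivity false; last by apply/esym/negP=> /pos_psums.
  by apply/negP=> /mem_descents[a [a' []]].
by have := eq_s (Ordinal (lt_k : k < n)%N); rewrite !inE => /= ->.
Qed.

End Descents.

(** * Sorting: words of content [c] against permutations with descents in [pset n c] *)

Section WordsOfComposition.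
Variables (n m : nat) (c : seq nat).
Hypotheses (c_comp : is_pcomp n c) (c_size : size c = m.+1).
Implicit Types (w : {ffun 'I_n -> 'I_m.+1}) (s : 'S_n).

Let c_sorted : sorted ltn (psums c).
Proof. by case/and3P: c_comp => _ /psums_sorted/path_sorted. Qed.

Let psums_size : size (psums c) = m.
Proof. by rewrite size_psums c_size. Qed.

(** Positions, counted from 0, are cut into consecutive segments of lengths [c]; this is the index
    of the segment of [p]. *)
Definition pos_block (p : 'I_n) : 'I_m.+1 := inord (count (leq^~ p) (psums c)).

Lemma pos_blockE p : pos_block p = count (leq^~ p) (psums c) :> nat.
Proof. by rewrite inordK // ltnS -psums_size count_size. Qed.

Lemma lt_pos_block p j : (j < m)%N -> (j < pos_block p)%N = (sumn (take j.+1 c) <= p)%N.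
Proof.
by move=> lt_j; rewrite pos_blockE count_leq_sorted ?psums_size // nth_psums // c_size.
Qed.

(** A value gets as letter the segment in which it stands in the one-line notation of [s]. *)
Definition perm_word s : {ffun 'I_n -> 'I_m.+1} := [ffun i => pos_block (s^-1%g i)].

Lemma perm_wordE s p : perm_word s (s p) = pos_block p.
Proof. by rewrite ffunE permK. Qed.

Lemma content_perm_word s : content (perm_word s) = c.
Proof.
have [c_gt0 _ /eqP c_sum] := and3P c_comp.
apply: psums_inj; rewrite ?size_content ?sumn_content //.
apply: (@eq_from_nth _ 0%N); first by rewrite !size_psums size_content c_size.
move=> j; rewrite size_psums size_content /= => lt_j.
rewrite !nth_psums ?size_content ?c_size // sumn_take_content; last exact: leqW.
rewrite -[RHS](@card_ord_lt n); last first.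
  by rewrite -c_sum -{2}(cat_take_drop j.+1 c) sumn_cat leq_addr.
rewrite -[RHS](card_imset _ (@perm_inj _ s)); apply: eq_card => i; rewrite inE.
rewrite -[i](permKV s) mem_imset; last exact: perm_inj.
by rewrite perm_wordE inE ltnS leqNgt lt_pos_block // -ltnNge.
Qed.

Section Position.
Variable w : {ffun 'I_n -> 'I_m.+1}.

(** Sorting by letter and then by value lists each fibre increasingly, so descents can occur only
    between fibres. *)
Definition lexlt (i' i : 'I_n) := (w i' < w i)%N || ((w i' == w i) && (i' < i)%N).

Lemma lexlt_irr i : lexlt i i = false.
Proof. by rewrite /lexlt !ltnn andbF. Qed.

Lemma lexlt_trans : transitive lexlt.
Proof. by move=> j i k; rewrite /lexlt -!val_eqE /=; lia. Qed.

Lemma lexlt_total i j : i != j -> lexlt i j || lexlt j i.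
Proof. by rewrite /lexlt -!val_eqE /=; lia. Qed.

Definition position i := #|[set i' | lexlt i' i]|.

Lemma lt_position i j : lexlt i j = (position i < position j)%N.
Proof.
have mono k l : lexlt k l -> (position k < position l)%N.
  move=> lt_kl; apply/proper_card/properP; split.
    by apply/subsetP=> i'; rewrite !inE => /lexlt_trans; apply.
  by exists k; rewrite !inE // lexlt_irr.
apply/idP/idP => [/mono//|lt_ij].
have neq_ij : i != j by apply: contraTneq lt_ij => ->; rewrite ltnn.
case/orP: (lexlt_total neq_ij) => // /mono.
by rewrite ltnNge (ltnW lt_ij).
Qed.

Lemma position_ltn i : (position i < n)%N.
Proof.
rewrite -[ltnRHS]card_ord -cardsT; apply/proper_card/properP; split=> //.
by exists i; rewrite !inE // lexlt_irr.
Qed.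

Lemma position_inj : injective (fun i => Ordinal (position_ltn i)).
Proof.
move=> i j /(congr1 val) /= eq_ij; apply/eqP/idPn => /lexlt_total.
by rewrite !lt_position eq_ij ltnn.
Qed.

Definition sorting_perm : 'S_n := (perm position_inj)^-1%g.

Lemma position_sorting p : position (sorting_perm p) = p.
Proof. by rewrite -[RHS](congr1 val (permKV (perm position_inj) p)) permE. Qed.

Hypothesis w_content : content w = c.

(** As [lexlt] compares letters first, the first [j.+1] fibres occupy exactly the places before
    their total size. *)
Lemma lt_position_block j i : (j < m)%N ->
  (sumn (take j.+1 c) <= position i)%N = (j < w i)%N.
Proof.
move=> lt_j; rewrite -w_content sumn_take_content; last exact: leqW.
case: (ltnP j (w i)) => [lt_jw|le_wj].
  apply/subset_leq_card/subsetP=> i'; rewrite !inE ltnS => le_wj.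
  by rewrite /lexlt (leq_ltn_trans le_wj).
apply/negbTE; rewrite -ltnNge; apply/proper_card/properP; split.
  by apply/subsetP=> i'; rewrite !inE /lexlt -val_eqE /=; lia.
by exists i; rewrite !inE // lexlt_irr.
Qed.

Lemma perm_word_sorting : perm_word sorting_perm = w.
Proof.
apply/ffunP=> i; rewrite -[i](permKV sorting_perm) perm_wordE.
move: (sorting_perm^-1%g i) => p; apply: val_inj => /=.
have lt_p j : (j < m)%N -> (j < pos_block p)%N = (j < w (sorting_perm p))%N.
  by move=> lt_j; rewrite lt_pos_block // -lt_position_block // position_sorting.
have := ltn_ord (pos_block p); have := ltn_ord (w (sorting_perm p)); rewrite !ltnS.
case: (ltngtP (pos_block p) (w (sorting_perm p))) => // lt_uv le_w le_p.
  by have := lt_p _ (leq_trans lt_uv le_w); rewrite ltnn lt_uv.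
by have := lt_p _ (leq_trans lt_uv le_p); rewrite ltnn lt_uv.
Qed.

Lemma desc_sorting : desc sorting_perm \subset pset n c.
Proof.
apply/subsetP=> a /descP[a' Da' lt_s]; rewrite inE.
have : lexlt (sorting_perm a) (sorting_perm a').
  by rewrite lt_position !position_sorting Da'.
rewrite /lexlt (ltnNge (sorting_perm a)) (ltnW lt_s) andbF orbF => lt_w.
have lt_m : (w (sorting_perm a) < m)%N.
  by apply: leq_trans lt_w _; rewrite -ltnS.
have := lt_position_block (sorting_perm a) lt_m.
have := lt_position_block (sorting_perm a') lt_m.
rewrite ltnn lt_w !position_sorting Da' => le_a /negbT; rewrite -ltnNge => lt_a.
apply/mem_psums; exists (w (sorting_perm a)).+1; first by rewrite c_size !ltnS.
by apply/eqP; rewrite eqn_leq lt_a le_a.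
Qed.

End Position.

(** A segment has no partial sum in its interior, hence no descent; the induction walks from [q] to
    [p] inside it. *)
Lemma perm_incr s (q p : 'I_n) : desc s \subset pset n c ->
  (q < p)%N -> pos_block q = pos_block p -> (s q < s p)%N.
Proof.
move=> /subsetP sub_s.
have mono (a b : 'I_n) : (a <= b)%N -> (pos_block a <= pos_block b)%N.
  move=> le_ab; rewrite !pos_blockE; apply: sub_count => x /= le_xa.
  exact: leq_trans le_xa le_ab.
elim: {p}(val p) {-2}p (erefl (val p)) => [|k IHk] p /= Dp; rewrite Dp //.
rewrite ltnS => le_qk eq_qp.
have lt_kn : (k < n)%N by have := ltn_ord p; rewrite Dp; apply: ltn_trans.
pose k' := Ordinal lt_kn.
have eq_qk : pos_block q = pos_block k'.
  apply: val_inj; apply/eqP; rewrite eqn_leq /= mono //= eq_qp mono //=.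
  by rewrite Dp.
have lt_kp : (s k' < s p)%N.
  rewrite ltn_neqAle leqNgt; apply/andP; split.
    rewrite val_eqE (inj_eq perm_inj) -val_eqE /= Dp.
    by rewrite neq_ltn ltnSn.
  apply/negP=> lt_s; have /sub_s : k' \in desc s by apply/descP; exists p.
  rewrite inE /= => /mem_psums[[//|j] lt_j Dj]; rewrite c_size !ltnS in lt_j.
  have := lt_pos_block p lt_j; have := lt_pos_block k' lt_j.
  by rewrite -eq_qk eq_qp -Dj Dp /= leqnn ltnn => -> .
have [->|neq_qk] := eqVneq q k'; first exact: lt_kp.
apply: ltn_trans lt_kp; apply: IHk => //.
by rewrite ltn_neqAle le_qk andbT; apply: contra neq_qk.
Qed.

(** Under the descent condition [s] lists the values increasingly for [lexlt], so sorting its word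
    recovers it. *)
Lemma position_perm_word s p : desc s \subset pset n c ->
  position (perm_word s) (s p) = p.
Proof.
move=> sub_s; have lex_s (q r : 'I_n) : (q < r)%N -> lexlt (perm_word s) (s q) (s r).
  move=> lt_qr; rewrite /lexlt !perm_wordE.
  have : (pos_block q <= pos_block r)%N.
    rewrite !pos_blockE; apply: sub_count => x /= le_xq.
    exact: leq_trans le_xq (ltnW lt_qr).
  rewrite leq_eqVlt => /orP[/eqP/val_inj eq_qr|->//].
  by rewrite eq_qr eqxx perm_incr ?orbT.
rewrite -[RHS](@card_ord_lt n); last exact: ltnW.
rewrite -[RHS](card_imset _ (@perm_inj _ s)); apply: eq_card => i.
rewrite -[i](permKV s) mem_imset ?inE; last exact: perm_inj.
move: (s^-1%g i) => q; case: (ltngtP q p) => [/lex_s //|/lex_s lt_pq|/val_inj->].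
  by apply/negbTE/negP=> /(lexlt_trans lt_pq); rewrite lexlt_irr.
by rewrite lexlt_irr.
Qed.

Lemma card_content :
  #|[set w : {ffun 'I_n -> 'I_m.+1} | content w == c]| =
  #|[set s : 'S_n | desc s \subset pset n c]|.
Proof.
rewrite -(card_in_imset (f := perm_word) (D := [set s : 'S_n | desc s \subset pset n c])).
  apply: eq_card => w; rewrite inE; apply/eqP/imsetP => [Dc|[s _ ->]].
    exists (sorting_perm w); last by rewrite perm_word_sorting.
    by rewrite inE desc_sorting.
  exact: content_perm_word.
move=> s t; rewrite !inE => sub_s sub_t eq_st; apply/permP=> p.
apply: (position_inj (w := perm_word s)); apply: val_inj => /=.
by rewrite position_perm_word // eq_st position_perm_word.
Qed.

End WordsOfComposition.

(** * The two Moebius functions *)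

(** If [Z] exceeds [D], toggling a fixed [x] of [Z] outside [D] reverses signs within the
    interval. *)
Lemma alternating_interval_sum (T : finType) (D Z : {set T}) : D \subset Z ->
  \sum_(A : {set T} | (D \subset A) && (A \subset Z)) (-1) ^+ (#|A| + #|D|)
  = (Z == D)%:R :> int.
Proof.
move=> sDZ; case: eqVneq => [->|neq_ZD].
  rewrite (eq_bigl (pred1 D)) => [|A]; last by rewrite -eqEsubset eq_sym.
  by rewrite big_pred1_eq -signr_odd oddD addbb.
have /subsetPn[x Zx nDx] : ~~ (Z \subset D).
  by apply: contraNN neq_ZD => sZD; rewrite eqEsubset sZD.
pose t (A : {set T}) := if x \in A then A :\ x else x |: A.
have tK : involutive t.
  move=> A; rewrite /t; case Ax: (x \in A); first by rewrite setD11 setD1K.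
  by rewrite setU11 setU1K ?Ax.
set S := \sum_(_ | _) _; suff : S = - S by lia.
have D_t (B : {set T}) : x \notin B -> (D \subset x |: B) = (D \subset B).
  by move=> xB; rewrite -[in RHS](setU1K xB) subsetD1 nDx andbT.
have Z_t (B : {set T}) : (x |: B \subset Z) = (B \subset Z).
  by rewrite subUset sub1set Zx.
rewrite {1}/S (reindex_inj (inv_inj tK)) /= -sumrN; apply: eq_big => [A|A _]; rewrite /t.
  case: ifPn => Ax; last by rewrite D_t ?Z_t.
  by rewrite -[in RHS](setD1K Ax) D_t ?Z_t // setD11.
case: ifPn => Ax; last by rewrite cardsU1 Ax add1n addSn exprS mulN1r.
by rewrite [in RHS](cardsD1 x A) Ax add1n addSn exprS mulN1r opprK.
Qed.

Section Counting.
Variables (n : nat) (F : pred pip).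

Lemma mem_pcomps c : (c \in pcomps n) = is_pcomp n c.
Proof.
by apply/idP/idP => [|/is_pcomp_mem//]; rewrite mem_filter => /andP[].
Qed.

Lemma mem_CF c : (c \in CF n F) = F (pcomp_type c) && is_pcomp n c.
Proof. by rewrite mem_filter mem_pcomps. Qed.

Lemma CF_uniq : uniq (CF n F).
Proof. by rewrite filter_uniq ?pcomps_uniq. Qed.

(** The words are sorted by content, which has the same type as the partition of the word;
    [card_content] counts each class. *)
Lemma card_words_type m :
  #|words (fun x : psp n => F (psp_type x)) m| =
  (\sum_(c <- CF n F | size c == m.+1) #|[set s : 'S_n | desc s \subset pset n c]|)%N.
Proof.
transitivity (\sum_(c <- CF n F | size c == m.+1)
    \sum_(w : {ffun 'I_n -> 'I_m.+1}) (content w == c : nat))%N; last first.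
  rewrite big_seq_cond [RHS]big_seq_cond; apply: eq_bigr => c.
  rewrite mem_CF => /andP[/andP[_ c_comp] /eqP c_size].
  by rewrite -(card_content c_comp c_size) -sum1dep_card [RHS]big_mkcond.
rewrite exchange_big -sum1dep_card big_mkcond; apply: eq_bigr => w _ /=.
have -> : (\sum_(c <- CF n F | size c == m.+1) (content w == c : nat))%N =
          (content w \in CF n F).
  rewrite -count_uniq_mem ?CF_uniq // -sum1_count [RHS]big_mkcond [LHS]big_mkcond.
  apply: eq_bigr => c _ /=; rewrite [in RHS]eq_sym.
  by case: (content w =P c) => [<-|_]; rewrite ?size_content ?eqxx ?if_same.
rewrite mem_CF content_pcomp andbC; case w_onto: (onto w); rewrite ?andbF //=.
by rewrite content_type //; case: (F _).
Qed.

(** Permutations are classified by exact descent set, and each subset of ['I_n] is the [pset] of one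
    composition. *)
Lemma sum_beta c : is_pcomp n c ->
  #|[set s : 'S_n | desc s \subset pset n c]|%:Z =
  \sum_(d <- pcomps n | pset n d \subset pset n c) (beta n d)%:Z.
Proof.
move=> c_comp.
transitivity (\sum_(d <- pcomps n | pset n d \subset pset n c)
                #|[set s : 'S_n | desc s == pset n d]|%:Z); last first.
  rewrite big_seq_cond [RHS]big_seq_cond; apply: eq_bigr => d /andP[+ _].
  by rewrite mem_pcomps => /betaE->.
rewrite (pcomps_pset_sum (fun A => A \subset pset n c)
          (fun A => #|[set s : 'S_n | desc s == A]|%:Z)).
rewrite -sum1dep_card (partition_big (@desc n) (fun A => A \subset pset n c)) //=.
rewrite -natz natr_sum; apply: eq_bigr => A sA; rewrite natz -sum1dep_card.
by congr Posz; apply: eq_bigl => s; case: eqP => [->|]; rewrite ?sA ?andbF.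
Qed.

Lemma PiF_sum (Q : pred (psp n)) (E : psp n -> int) :
  \sum_(x <- PiF n F | Q x) E x = \sum_(x | is_psp x && (F (psp_type x) && Q x)) E x.
Proof.
rewrite /PiF big_filter_cond big_enum_cond /=.
by apply: eq_bigl => x; rewrite inE -!andbA.
Qed.

Lemma mem_PiF x : (x \in PiF n F) = is_psp x && F (psp_type x).
Proof. by rewrite mem_filter mem_enum inE andbT. Qed.

Hypothesis F_filter : is_nonempty_filter n F.

Lemma psp_top_valid : is_psp (psp_top n).
Proof.
apply/and3P; split; rewrite ?inE //=; last by apply/trivIsetP=> A B; rewrite inE.
by rewrite /cover big_set0 setCT.
Qed.

Lemma psp_le_top (x : psp n) : psp_le x (psp_top n).
Proof. by apply/psp_leP; split=> [|B _]; [|left]; apply: subsetT. Qed.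

Lemma psp_top_PiF : psp_top n \in PiF n F.
Proof.
rewrite mem_PiF psp_top_valid /=; case: F_filter => F_pip [[l k] Fx] F_up.
have /and3P[/= l_sorted l_pos /eqP l_sum] := F_pip _ Fx.
apply: F_up Fx; rewrite /psp_type /= enum_set0 cardsT card_ord.
have canon_l : canon l = l.
  by apply: sorted_sort => // x y z /= xy zx; apply: leq_trans zx xy.
have := @raw_le_absorb_seq n l [::] k.
by rewrite cats0 /raw_le canon_l l_sum; apply.
Qed.

(** Everything above [z] has its type in [F], so this is a full upper interval, where words cancel
    unless [z] has no nonzero block. *)
Lemma psp_sum_above z : z \in PiF n F ->
  \sum_(x <- PiF n F | psp_le z x && psp_le x (psp_top n))
     (-1) ^+ #|x.1| * (#|x.1|`!)%:Z = (z == psp_top n)%:R :> int.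
Proof.
rewrite mem_PiF => /andP[z_psp Fz]; rewrite PiF_sum.
have F_up x : is_psp x -> psp_le z x -> F (psp_type x).
  by case: F_filter => _ _ up x_psp /(psp_le_type z_psp x_psp)/up; apply.
rewrite (eq_bigl (fun x : psp n => is_psp x && psp_le z x)); last first.
  move=> x; rewrite psp_le_top andbT; case x_psp: (is_psp x) => //=.
  by case le_zx: (psp_le z x); rewrite ?andbF // F_up.
have [->|z_top] := eqVneq z (psp_top n).
  rewrite (big_pred1 (psp_top n)) ?cards0 // => x /=; apply/andP/eqP => [[x_psp le_x]|->].
    by apply: psp_le_anti; rewrite ?psp_top_valid ?psp_le_top.
  by rewrite psp_top_valid psp_le_refl.
rewrite psp_sum_words words_above_sum //; apply: contraNneq z_top => z0.
apply/eqP; rewrite [LHS]surjective_pairing z0; congr (_, _).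
have := cover_partition z_psp; rewrite z0 /cover big_set0.
by move/esym/(canRL setCK); rewrite setC0.
Qed.

Lemma mobius_PiF :
  mobius (with_bot (PiF n F)) (le_bot (@psp_le n)) None (Some (psp_top n)) =
  - \sum_(c <- CF n F) (-1) ^+ (size c).-1
      * #|[set s : 'S_n | desc s \subset pset n c]|%:Z.
Proof.
rewrite (mobius_bot_dual _ _ _ _
  (g := fun x : psp n => (-1) ^+ #|x.1| * (#|x.1|`!)%:Z)); first last.
- by move=> z Fz _; apply: psp_sum_above.
- exact: psp_top_PiF.
- by move=> x y z _ _ _ ; apply: psp_le_trans.
- move=> x y; rewrite !mem_PiF => /andP[x_psp _] /andP[y_psp _].
  exact: psp_le_anti.
- by move=> x _; apply: psp_le_refl.
- by rewrite filter_uniq ?enum_uniq.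
congr (- _); rewrite PiF_sum.
rewrite (eq_bigl (fun x : psp n => is_psp x && F (psp_type x))); last first.
  by move=> x; rewrite psp_le_top andbT.
rewrite psp_sum_words.
transitivity (\sum_(m < n.+1) \sum_(c <- CF n F | size c == m.+1)
   (-1) ^+ (size c).-1 * #|[set s : 'S_n | desc s \subset pset n c]|%:Z : int).
  apply: eq_bigr => m _; rewrite card_words_type -natz natr_sum mulr_sumr.
  by apply: eq_bigr => c /eqP->; rewrite natz.
(* Each composition has a single size, so the sum over alphabet sizes collapses. *)
rewrite (exchange_big_dep predT) //= big_seq [RHS]big_seq.
apply: eq_bigr => c; rewrite mem_CF => /andP[_ c_comp].
have [c_gt0 _ _] := and3P c_comp.
have lt_c : ((size c).-1 < n.+1)%N.
  by rewrite ltnS -(card_pset c_comp) -[leqRHS]card_ord max_card.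
rewrite (big_pred1 (Ordinal lt_c)) // => m /=.
by rewrite -val_eqE /= -[in LHS](prednK c_gt0) eqSS eq_sym.
Qed.

Lemma CF_up c d : c \in CF n F -> is_pcomp n d -> pcomp_le c d -> d \in CF n F.
Proof.
rewrite !mem_CF => /andP[Fc c_comp] -> le_cd; rewrite andbT.
by case: F_filter => _ _ up; apply: up Fc; apply: pcomp_le_type le_cd.
Qed.

Lemma CF_pcomp c : c \in CF n F -> is_pcomp n c.
Proof. by rewrite mem_CF => /andP[]. Qed.

(** Intervals above [z] stay in the filter and are Boolean, so the dual function is a sign,
    normalised to be 1 at [d]. *)
Lemma mobius_CF d : d \in CF n F ->
  mobius (with_bot (CF n F)) (le_bot pcomp_le) None (Some d) =
  - \sum_(c <- CF n F | pcomp_le c d) (-1) ^+ ((size c).-1 + (size d).-1).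
Proof.
move=> Fd.
apply: (mobius_bot_dual _ _ _ _
  (g := fun c => (-1) ^+ ((size c).-1 + (size d).-1))) => //.
- exact: CF_uniq.
- by move=> c /CF_pcomp c_comp; rewrite (pcomp_leE c_comp c_comp).
- move=> c e /CF_pcomp c_comp /CF_pcomp e_comp; rewrite !(@pcomp_leE n) // => ce ec.
  by apply: (pset_inj c_comp e_comp); apply/eqP; rewrite eqEsubset ce ec.
- move=> e c f /CF_pcomp ? /CF_pcomp ? /CF_pcomp ?; rewrite !(@pcomp_leE n) // => ec cf.
  exact: subset_trans cf ec.
move=> z Fz; have z_comp := CF_pcomp Fz; have d_comp := CF_pcomp Fd.
rewrite (pcomp_leE z_comp d_comp) => sub_dz.
have -> : (z == d) = (pset n z == pset n d).
  by apply/eqP/eqP => [->|/(pset_inj z_comp d_comp)].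
rewrite -(alternating_interval_sum sub_dz).
rewrite -(pcomps_pset_sum (fun A => (pset n d \subset A) && (A \subset pset n z))
  (fun A => (-1) ^+ (#|A| + #|pset n d|))).
rewrite big_filter_cond big_seq_cond [RHS]big_seq_cond.
apply: eq_big => c; rewrite mem_pcomps; case c_comp: (is_pcomp n c) => //=.
  rewrite !(@pcomp_leE n) // [RHS]andbC.
  case sub_cz: (pset n c \subset pset n z) => /=; rewrite ?andbF //.
  have : c \in CF n F by apply: (CF_up Fz) => //; rewrite (pcomp_leE z_comp).
  by rewrite mem_CF => /andP[->].
by rewrite !card_pset.
Qed.

End Counting.

Theorem theorem3p1 (n : nat) (F : pred pip) :
  is_nonempty_filter n F ->
  mobius (with_bot (PiF n F)) (le_bot (@psp_le n)) None (Some (psp_top n)) =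
  \sum_(c <- CF n F)
     (-1) ^+ (size c).-1
     * mobius (with_bot (CF n F)) (le_bot pcomp_le) None (Some c)
     * (beta n c)%:Z.
Proof.
move=> F_filter; rewrite mobius_PiF //.
transitivity (- \sum_(c <- CF n F) \sum_(d <- CF n F | pcomp_le c d)
                  (-1) ^+ (size c).-1 * (beta n d)%:Z : int).
  (* Compositions above [c] remain in [CF n F], so restricting [sum_beta] to them loses nothing. *)
  congr (- _); rewrite big_seq [RHS]big_seq; apply: eq_bigr => c Fc.
  have c_comp := CF_pcomp Fc; rewrite sum_beta // mulr_sumr.
  rewrite [RHS]big_filter_cond big_seq_cond [RHS]big_seq_cond.
  apply: eq_bigl => d; rewrite mem_pcomps; case d_comp: (is_pcomp n d) => //=.
  rewrite (pcomp_leE c_comp d_comp); case le_cd: (_ \subset _); rewrite ?andbF //.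
  have : d \in CF n F by apply: (CF_up F_filter Fc) => //; rewrite (pcomp_leE c_comp).
  by rewrite mem_CF => /andP[->].
rewrite (exchange_big_dep predT) //= -sumrN big_seq [RHS]big_seq.
apply: eq_bigr => d Fd; rewrite mobius_CF // mulrN mulNr mulr_sumr mulr_suml.
(* The sign of [d] comes twice, from the statement and from [mobius_CF], and squares to 1. *)
congr (- _); apply: eq_bigr => c _; rewrite -exprD addnCA exprD.
by rewrite addnn -[X in _ = _ * X * _]signr_odd odd_double mulr1.
Qed.
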